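(* Consider the finite-sum problem $\min_{\mathbf{w}\in\mathbb{R}^d}F(\mathbf{w})=\frac1m\sum_{i=1}^mf_i\big(\frac1n\sum_{j=1}^ng_i(\mathbf{w};\xi_{ij})\big)$ under assumptions (A1)–(A4) below, and run MSVR-v3 (described below) with batch sizes $B_1,B_2$, $I=\frac{mn}{B_1B_2}$, $\alpha=c_1\frac{B_1B_2}{mn}$, $\beta=c_2\frac{B_2}{n}$ and $\eta=c_3\frac{B_1\sqrt{B_2}}{m\sqrt n}$ for suitable constants $c_1,c_2,c_3>0$ depending only on the problem constants. Then MSVR-v3 obtains an $\epsilon$-stationary point (output $\mathbf{w}_\tau$ with $\mathbb{E}\|\nabla F(\mathbf{w}_\tau)\|\le\epsilon$) in $T=\mathcal{O}\big(\frac{m\sqrt n\,\epsilon^{-2}}{B_1\sqrt{B_2}}\big)$ iterations.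
   Context: Let $g_i(\mathbf{w})=\frac1n\sum_{j=1}^ng_i(\mathbf{w};\xi_{ij})$, $g_i:\mathbb{R}^d\to\mathbb{R}^p$, $f_i:\mathbb{R}^p\to\mathbb{R}$. A stochastic sample $\xi$ for block $i$ is a mini-batch of $B_2$ elements of $\{\xi_{i1},\dots,\xi_{in}\}$ drawn uniformly, with $g_i(\mathbf{w};\xi)$, $\nabla g_i(\mathbf{w};\xi)\in\mathbb{R}^{p\times d}$ the batch averages. (A1) each $f_i$ $L_f$-smooth and $C_f$-Lipschitz, each $g_i$ $L_g$-smooth and $C_g$-Lipschitz. (A2) $\mathbb{E}\|g_i(\mathbf{x};\xi)-g_i(\mathbf{x})\|^2\le\sigma^2/B_2$, $\mathbb{E}\|\nabla g_i(\mathbf{x};\xi)-\nabla g_i(\mathbf{x})\|^2\le\sigma^2/B_2$. (A3) $\mathbb{E}\|g_i(\mathbf{x};\xi)-g_i(\mathbf{y};\xi)\|^2\le C_g^2\|\mathbf{x}-\mathbf{y}\|^2$, $\mathbb{E}\|\nabla g_i(\mathbf{x};\xi)-\nabla g_i(\mathbf{y};\xi)\|^2\le L_g^2\|\mathbf{x}-\mathbf{y}\|^2$. (A4) $F_*=\inf F>-\infty$, $F(\mathbf{w}_1)-F_*\le\Delta_F$. MSVR-v3 (parameters $\alpha,\beta,\eta,I$, $\gamma=\frac{m-B_1}{B_1(1-\beta)}+(1-\beta)$; initial $\mathbf{w}_1,\mathbf{u}_1,\mathbf{z}_1$): at iteration $t$, if $t\bmod I=0$ set $\tau=t$ and compute and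 store $g_i(\mathbf{w}_\tau)$ and $\nabla f_i(\mathbf{u}^i_{\tau-1})$ for all $i$ and $\bar G_\tau=\frac1m\sum_{i=1}^m\nabla g_i(\mathbf{w}_\tau)^\top\nabla f_i(\mathbf{u}^i_{\tau-1})$ ($\tau$ denotes the latest such index). Draw $\mathcal{B}_1^t\subseteq[m]$ of size $B_1$ uniformly and fresh $\xi_t^i$, $i\in\mathcal{B}_1^t$. Let $\hat g_i(\mathbf{w}_t;\xi_t^i)=g_i(\mathbf{w}_t;\xi_t^i)-g_i(\mathbf{w}_\tau;\xi_t^i)+g_i(\mathbf{w}_\tau)$; set $\mathbf{u}_t^i=(1-\beta)\mathbf{u}_{t-1}^i+\beta\hat g_i(\mathbf{w}_t;\xi_t^i)+\gamma(g_i(\mathbf{w}_t;\xi_t^i)-g_i(\mathbf{w}_{t-1};\xi_t^i))$ for $i\in\mathcal{B}_1^t$ and $\mathbf{u}_t^i=\mathbf{u}_{t-1}^i$ otherwise. With $G_i(\mathbf{w},\mathbf{v};\xi)=\nabla g_i(\mathbf{w};\xi)^\top\nabla f_i(\mathbf{v})$, let $\mathbf{h}_t=\frac1{B_1}\sum_{i\in\mathcal{B}_1^t}(G_i(\mathbf{w}_t,\mathbf{u}^i_{t-1};\xi_t^i)-G_i(\mathbf{w}_\tau,\mathbf{u}^i_{\tau-1};\xi_t^i))+\bar G_\tau$ and $\mathbf{z}_t=(1-\alpha)\mathbf{z}_{t-1}+\alpha\mathbf{h}_t+\frac{1-\alpha}{B_1}\sum_{i\in\mathcal{B}_1^t}(G_i(\mathbf{w}_t,\mathbf{u}^i_{t-1};\xi_t^i)-G_i(\mathbf{w}_{t-1},\mathbf{u}^i_{t-2};\xi_t^i))$;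 then $\mathbf{w}_{t+1}=\mathbf{w}_t-\eta\mathbf{z}_t$. Output $\mathbf{w}_\tau$ with $\tau$ uniform in $\{1,\dots,T\}$.
   Formalization: The initial estimators are taken exact, u_1^i = g_i(w_1) and z_1 = ∇F(w_1), since for arbitrary u_1, z_1 the rate fails (e.g. z_1 = 0 with n large); I = mn/(B_1B_2) is required to be an integer, and the first anchor is τ = 1 with u_0 = u_1. *)

(* Defs.v *)
From HB Require Import structures.
From mathcomp Require Import all_boot all_order all_algebra.
From mathcomp Require Import all_classical all_reals all_analysis.
Set Implicit Arguments. Unset Strict Implicit. Unset Printing Implicit Defensive.
Import Order.TTheory GRing.Theory Num.Theory.
Local Open Scope ring_scope.

Section MSVR.
Variable R : realType.

Definition enorm (k : nat) (v : 'cV[R]_k) : R :=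
  Num.sqrt (\sum_(i < k) v i 0 ^+ 2).
Definition fnorm (a b : nat) (A : 'M[R]_(a, b)) : R :=
  Num.sqrt (\sum_(i < a) \sum_(j < b) A i j ^+ 2).
Definition dotv (k : nat) (u v : 'cV[R]_k) : R := \sum_(i < k) u i 0 * v i 0.

Definition Ebatch (n B : nat) (X : {set 'I_n} -> R) : R :=
  (\sum_(S : {set 'I_n} | #|S| == B) X S) /
  #|[set S : {set 'I_n} | #|S| == B]|%:R.

Variables (d p m n : nat).
(* gs i j w = g_i(w; xi_ij),  Jg i j w = its Jacobian (p x d). *)
Variable gs : 'I_m -> 'I_n -> 'cV[R]_d -> 'cV[R]_p.
Variable Jg : 'I_m -> 'I_n -> 'cV[R]_d -> 'M[R]_(p, d).
Variable gradf : 'I_m -> 'cV[R]_p -> 'cV[R]_p.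

Definition gB (B2 : nat) (i : 'I_m) (xi : {set 'I_n}) (w : 'cV[R]_d) : 'cV[R]_p :=
  (B2%:R)^-1 *: \sum_(j in xi) gs i j w.
Definition JB (B2 : nat) (i : 'I_m) (xi : {set 'I_n}) (w : 'cV[R]_d) : 'M[R]_(p, d) :=
  (B2%:R)^-1 *: \sum_(j in xi) Jg i j w.
Definition gfull (i : 'I_m) (w : 'cV[R]_d) : 'cV[R]_p :=
  (n%:R)^-1 *: \sum_(j < n) gs i j w.
Definition Jfull (i : 'I_m) (w : 'cV[R]_d) : 'M[R]_(p, d) :=
  (n%:R)^-1 *: \sum_(j < n) Jg i j w.

(* One iteration's randomness: the block batch B_1^t and, for every block i,
   a fresh inner mini-batch xi_t^i (only those with i in B_1^t are used). *)
Definition sample := ({set 'I_m} * {ffun 'I_m -> {set 'I_n}})%type.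
Definition valid_sample (B1 B2 : nat) (s : sample) : bool :=
  (#|s.1| == B1) && [forall i, #|s.2 i| == B2].

Record state := State {
  w_next : 'cV[R]_d;
  w_cur  : 'cV[R]_d;
  u_cur  : 'I_m -> 'cV[R]_p;
  u_prev : 'I_m -> 'cV[R]_p;
  z_cur  : 'cV[R]_d;
  w_tau  : 'cV[R]_d;
  u_tau  : 'I_m -> 'cV[R]_p     (* u_{tau-1} at the latest anchor *)
}.

Variables (B1 B2 I : nat) (alpha beta eta : R).
Variables (w1 : 'cV[R]_d) (u1 : 'I_m -> 'cV[R]_p) (z1 : 'cV[R]_d).

Definition gamma : R := (m - B1)%:R / (B1%:R * (1 - beta)) + (1 - beta).

Definition Gi (i : 'I_m) (w : 'cV[R]_d) (v : 'cV[R]_p) (xi : {set 'I_n}) : 'cV[R]_d :=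
  (JB B2 i xi w)^T *m gradf i v.

(* Iteration 1 = initialisation (w_1, u_1, z_1 given; u_0 := u_1, w_0 := w_1;
   the initial anchor is tau = 1). *)
Definition init : state :=
  State (w1 - eta *: z1) w1 u1 u1 z1 w1 u1.

(* Iteration t >= 2, from the state of iteration t-1. *)
Definition step (t : nat) (s : state) (smp : sample) : state :=
  let wt := w_next s in
  let wp := w_cur s in
  let anchor := (t %% I == 0)%N in
  let wtau := if anchor then wt else w_tau s in
  let utau := if anchor then u_cur s else u_tau s in
  let Bs := smp.1 in
  let xi := smp.2 in
  let ghat i := gB B2 i (xi i) wt - gB B2 i (xi i) wtau + gfull i wtau in
  let ut i := if i \in Bs then
                (1 - beta) *: u_cur s i + beta *: ghat i
                + gamma *: (gB B2 i (xi i) wt - gB B2 i (xi i) wp)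
              else u_cur s i in
  let Gbar := (m%:R)^-1 *: \sum_(i < m) ((Jfull i wtau)^T *m gradf i (utau i)) in
  let h := (B1%:R)^-1 *: \sum_(i in Bs)
             (Gi i wt (u_cur s i) (xi i) - Gi i wtau (utau i) (xi i)) + Gbar in
  let zt := (1 - alpha) *: z_cur s + alpha *: h
            + ((1 - alpha) / B1%:R) *: \sum_(i in Bs)
                (Gi i wt (u_cur s i) (xi i) - Gi i wp (u_prev s i) (xi i)) in
  State (wt - eta *: zt) wt ut (u_cur s) zt wtau utau.

Fixpoint run (omega : nat -> sample) (t : nat) : state :=
  match t with
  | 0 => init
  | t'.+1 => if t' is 0 then init else step t (run omega t') (omega t)
  end.

Definition iterate (omega : nat -> sample) (t : nat) : 'cV[R]_d := w_cur (run omega t).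

(* Randomness of a run of T iterations: one sample per index in 'I_T.+1
   (index t is used at iteration t; indices 0,1 are unused). *)
Definition path (T : nat) := {ffun 'I_T.+1 -> sample}.
Definition default_sample : sample := (finset.set0, [ffun => finset.set0]).
Definition path_fun (T : nat) (om : path T) : nat -> sample :=
  fun t => match insub t with Some k => om k | None => default_sample end.
Definition valid_path (T : nat) (om : path T) : bool :=
  [forall k, valid_sample B1 B2 (om k)].

Definition Epath (T : nat) (X : path T -> R) : R :=
  (\sum_(om : path T | valid_path om) X om) / #|[set om : path T | valid_path om]|%:R.

(* E || grad F(w_tau) || with tau uniform in {1,...,T}. *)
Definition expected_output_gradnorm (gradF : 'cV[R]_d -> 'cV[R]_d) (T : nat) : R :=
  Epath (fun om : path T =>
    (T%:R)^-1 * \sum_(1 <= t < T.+1) enorm (gradF (iterate (path_fun om) t))).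

End MSVR.

Definition Fobj (R : realType) (d p m n : nat)
  (f : 'I_m -> 'cV[R]_p -> R) (gs : 'I_m -> 'I_n -> 'cV[R]_d -> 'cV[R]_p)
  (w : 'cV[R]_d) : R :=
  (m%:R)^-1 * \sum_(i < m) f i (gfull gs i w).

(* Main.v *)
Require Import Defs.
From HB Require Import structures.
From mathcomp Require Import all_boot all_order all_algebra.
From mathcomp Require Import all_classical all_reals all_analysis.
From mathcomp Require Import perm ring lra.
Import Order.TTheory GRing.Theory Num.Theory.
Local Open Scope ring_scope.
Set Implicit Arguments. Unset Strict Implicit. Unset Printing Implicit Defensive.

(* Write a = B1/m and b = B2/n, so that alpha = ab, beta = b/2, I = 1/(ab) and
   eta = c3 a sqrt b.  Conditionally on the past, one iteration contracts the
   errors |u - g(w)|^2 and |z - Gbar|^2, where Gbar is the mean of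
   J_i(w_t)^T grad f_i(u_{t-1}), by 1 - a beta and 1 - alpha, up to multiples of
   the squared displacement |w_t - w_{t-1}|^2 = eta^2 |z|^2, of the drift of w and
   u since the last anchor, and of the squared change of u; gamma is chosen so that
   the cross term <u - g(w), g(w_t) - g(w_{t-1})> cancels in expectation.  Drifts
   over an epoch of length at most I cost a factor I^2.  Summing over t, the total
   of E |grad F(w_t) - z_t|^2 is at most C c3^2 times the total of E |z_t|^2, with
   no initial error since u_1 and z_1 are exact, and for c3 small this is absorbed
   by the term - eta/2 |z_t|^2 of the descent inequality. *)

(** * Finite averages, random batches and Euclidean norms *)

(** The bounds are triangular: displacement controls the anchor drift of w, this drift the error of
    u, then the increments of u and their anchor drift, then the error of z. Only the descent
    inequality closes the loop, so no joint Lyapunov function is built. The scale comes from the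
    gamma term: being of size 1/a and applied with probability a, it costs D/a against a contraction
    rate ab/2, where D is the total squared displacement. Hence every error total entering the
    gradient error is of order D/(a^2 b); as D is eta^2 times the total of |z|^2, eta must be
    proportional to a sqrt b. The epoch factor I^2 does no harm because anchored differences always
    enter through the squared step sizes beta^2 or alpha^2. All expectations are averages over
    finite sets, so conditioning on the past amounts to averaging out one coordinate of a finite
    product. *)

Section Average.
Context {R : realType} {T : finType}.
Implicit Types (P : pred T) (X Y : T -> R).

(** [Ebatch], [Epath] and the conditional mean over one [sample] are all convertible to [avg], hence
    the changes of goal to [avg _ _] below. Over an empty [P] the value is 0, so [avg_cst] asks for
    a witness. *)
Definition avg P X : R := (\sum_(x | P x) X x) / #|[set x | P x]|%:R.

Lemma natr_card_set P : #|[set x | P x]|%:R = \sum_(x | P x) 1 :> R.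
Proof. by rewrite sumr_const cardsE. Qed.

Lemma eq_avg P X Y : (forall x, P x -> X x = Y x) -> avg P X = avg P Y.
Proof. by move=> XY; rewrite /avg (eq_bigr _ XY). Qed.

Lemma ler_avg P X Y : (forall x, P x -> X x <= Y x) -> avg P X <= avg P Y.
Proof. by move=> XY; rewrite ler_wpM2r ?invr_ge0 ?ler0n// ler_sum. Qed.

Lemma avgD P X Y : avg P (fun x => X x + Y x) = avg P X + avg P Y.
Proof. by rewrite /avg big_split mulrDl. Qed.

Lemma avgZ P c X : avg P (fun x => c * X x) = c * avg P X.
Proof. by rewrite /avg -mulr_sumr mulrA. Qed.

Lemma avgN P X : avg P (fun x => - X x) = - avg P X.
Proof. by rewrite /avg sumrN mulNr. Qed.

Lemma avgB P X Y : avg P (fun x => X x - Y x) = avg P X - avg P Y.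
Proof. by rewrite avgD avgN. Qed.

Lemma avg_sum P (J : Type) (r : seq J) (Q : pred J) (X : J -> T -> R) :
  avg P (fun x => \sum_(j <- r | Q j) X j x) = \sum_(j <- r | Q j) avg P (X j).
Proof. by rewrite /avg exchange_big/= mulr_suml. Qed.

Lemma avg_ge0 P X : (forall x, P x -> 0 <= X x) -> 0 <= avg P X.
Proof. by move=> X0; rewrite divr_ge0 ?ler0n// sumr_ge0. Qed.

Lemma avg_cst P c x0 : P x0 -> avg P (fun=> c) = c.
Proof.
move=> Px0; rewrite /avg sumr_const cardsE -[c *+ _]mulr_natr mulfK//.
by rewrite pnatr_eq0 -lt0n; apply/card_gt0P; exists x0.
Qed.

End Average.

(** Independence of the components of a uniform pair. The cardinality is a sum of products [1 * 1],
    so one distributivity law factors numerator and denominator alike. *)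
Lemma avg_prod {R : realType} (S T : finType) (P : pred S) (Q : pred T)
    (X : S -> R) (Y : T -> R) :
  avg (fun s : S * T => P s.1 && Q s.2) (fun s => X s.1 * Y s.2) =
  avg P X * avg Q Y.
Proof.
have big_prod (A : S -> R) (B : T -> R) :
    \sum_(s : S * T | P s.1 && Q s.2) A s.1 * B s.2 =
    (\sum_(x | P x) A x) * (\sum_(y | Q y) B y).
  by rewrite big_distrlr/= pair_big.
rewrite /avg !natr_card_set big_prod.
under [X in _ / X]eq_bigr do rewrite -[1]mulr1.
by rewrite (big_prod (fun=> 1) (fun=> 1)) invfM; ring.
Qed.

Section Product.
Context {R : realType} {J A : finType}.
Implicit Types (P : pred A) (f : {ffun J -> A}).

Definition upd f k s : {ffun J -> A} := [ffun j => if j == k then s else f j].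

(* The involution (f, s) |-> (f[k := s], f k) preserves the uniform law on the
   product space, which is what independence of coordinate [k] amounts to. *)
Lemma avg_ffun_fubini P k (H : {ffun J -> A} -> A -> R) s0 : P s0 ->
  (forall f s t, H (upd f k s) t = H f t) ->
  avg (fun f => [forall j, P (f j)]) (fun f => H f (f k)) =
  avg (fun f => [forall j, P (f j)]) (fun f => avg P (H f)).
Proof.
move=> Ps0 Hk; set Q := fun f => [forall j, P (f j)].
pose N : R := #|[set x | P x]|%:R.
have N0 : N != 0.
  by rewrite pnatr_eq0 -lt0n cardsE; apply/card_gt0P; exists s0.
rewrite /avg -mulr_suml; congr (_ / _); apply: (mulIf N0); rewrite divfK//.
rewrite /N natr_card_set.
rewrite mulr_suml; under eq_bigr do rewrite mulr_sumr.
under eq_bigr do under eq_bigr do rewrite mulr1.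
rewrite exchange_big/= !pair_big/=.
pose F' (x : {ffun J -> A} * A) := (x.1 k, upd x.1 k x.2).
pose G (x : A * {ffun J -> A}) := (upd x.2 k x.1, x.2 k).
have GK : cancel (fun x : {ffun J -> A} * A => F' x) G.
  move=> [f s]; rewrite /G /F'/=; congr (_, _).
    by apply/ffunP => j; rewrite !ffunE; case: eqP => [->|].
  by rewrite ffunE eqxx.
have KG : cancel G F'.
  move=> [s f]; rewrite /G /F'/=; congr (_, _).
    by rewrite ffunE eqxx.
  by apply/ffunP => j; rewrite !ffunE; case: eqP => [->|].
rewrite (reindex F') /=; last by exists G => ? _; [exact: GK|exact: KG].
apply: eq_big => [[f s]|[f s] _] /=; last by rewrite ffunE eqxx Hk.
apply/andP/andP => -[].
  move=> Pfk /forallP Pf; split; last first.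
    by have := Pf k; rewrite ffunE eqxx.
  by apply/forallP => j; have := Pf j; rewrite ffunE; case: eqP => [->|].
move=> /forallP Pf Ps; split; first exact: Pf.
by apply/forallP => j; rewrite ffunE; case: eqP.
Qed.

Lemma avg_ffun_coord P k (X : A -> R) s0 : P s0 ->
  avg (fun f : {ffun J -> A} => [forall j, P (f j)]) (fun f => X (f k)) = avg P X.
Proof.
move=> Ps0; rewrite (@avg_ffun_fubini P k (fun=> X) s0)//.
apply: (@avg_cst _ _ _ _ [ffun=> s0]).
by apply/forallP => j; rewrite ffunE.
Qed.

End Product.

Section Draws.
Context {R : realType}.
Variable n : nat.

Lemma draw_exists B : (B <= n)%N -> exists S : {set 'I_n}, #|S| == B.
Proof.
move=> Bn.
have : (0 < #|[set S : {set 'I_n} | #|S| == B]|)%N.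
  by rewrite card_draws card_ord bin_gt0.
by case/card_gt0P => S; rewrite inE => SB; exists S.
Qed.

(** Transpositions permute the subsets of size [B], so all indices have the same inclusion
    probability, and these probabilities add up to [B]. *)
Lemma avg_draw_mem B (j : 'I_n) : (B <= n)%N ->
  avg (fun S : {set 'I_n} => #|S| == B) (fun S => (j \in S)%:R : R) = B%:R / n%:R.
Proof.
move=> Bn; have [S0 S0B] := draw_exists Bn.
have n0 : n%:R != 0 :> R by case: n j => [[]|k _]; rewrite ?pnatr_eq0.
pose p k : R := avg (fun S : {set 'I_n} => #|S| == B) (fun S => (k \in S)%:R).
have pE k l : p k = p l.
  rewrite /p /avg; congr (_ / _).
  rewrite (reindex_inj (imset_inj (@perm_inj _ (tperm k l)))) /=.
  apply: eq_big => [S|S _]; first by rewrite card_imset//; exact: perm_inj.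
  by rewrite -[k in k \in _](tpermR k l) mem_imset//; exact: perm_inj.
have : \sum_k p k = B%:R.
  rewrite /p -avg_sum -[RHS](@avg_cst R _ (fun S : {set 'I_n} => #|S| == B) _ S0 S0B).
  apply: eq_avg => S /eqP <-; rewrite -sum1_card natr_sum [RHS]big_mkcond/=.
  by apply: eq_bigr => i _; case: (i \in S).
rewrite (eq_bigr (fun=> p j)) => [|k _]; last exact: pE.
by rewrite sumr_const card_ord -[p j *+ _]mulr_natr => /(canRL (mulfK n0)).
Qed.

Lemma avg_draw_sum B (x : 'I_n -> R) : (0 < B)%N -> (B <= n)%N ->
  avg (fun S : {set 'I_n} => #|S| == B) (fun S => B%:R^-1 * \sum_(j in S) x j) =
  n%:R^-1 * \sum_j x j.
Proof.
move=> B0 Bn; rewrite avgZ.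
under eq_avg => S _.
  rewrite big_mkcond/=.
  under eq_bigr => j _.
    rewrite (_ : (if _ then _ else _) = x j * (j \in S)%:R); last first.
      by case: (j \in S); rewrite ?mulr1 ?mulr0.
    over.
  over.
rewrite avg_sum.
under eq_bigr do rewrite avgZ avg_draw_mem//.
rewrite -mulr_suml.
have B1 : B%:R != 0 :> R by rewrite pnatr_eq0 -lt0n.
by rewrite mulrCA mulKf// mulrC.
Qed.

End Draws.

Section SquaredNorm.
Context {R : realType}.

Definition sqn k (v : 'cV[R]_k) : R := \sum_(i < k) v i 0 ^+ 2.
Definition sqf a b (A : 'M[R]_(a, b)) : R := \sum_(i < a) \sum_(j < b) A i j ^+ 2.

Lemma sqn_ge0 k (v : 'cV[R]_k) : 0 <= sqn v.
Proof. by apply: sumr_ge0 => i _; exact: sqr_ge0. Qed.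

Lemma sqf_ge0 a b (A : 'M[R]_(a, b)) : 0 <= sqf A.
Proof. by apply: sumr_ge0 => i _; apply: sumr_ge0 => j _; exact: sqr_ge0. Qed.

Lemma enorm_ge0 k (v : 'cV[R]_k) : 0 <= enorm v.
Proof. exact: sqrtr_ge0. Qed.

Lemma sqr_enorm k (v : 'cV[R]_k) : enorm v ^+ 2 = sqn v.
Proof. by rewrite sqr_sqrtr// sqn_ge0. Qed.

Lemma sqr_fnorm a b (A : 'M[R]_(a, b)) : fnorm A ^+ 2 = sqf A.
Proof. by rewrite sqr_sqrtr// sqf_ge0. Qed.

Lemma sqr_enorm_le k (v : 'cV[R]_k) c : 0 <= c -> (enorm v <= c) = (sqn v <= c ^+ 2).
Proof. by move=> c0; rewrite -sqr_enorm ler_sqr// ?nnegrE ?enorm_ge0. Qed.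

Lemma sqnZ k (c : R) (v : 'cV[R]_k) : sqn (c *: v) = c ^+ 2 * sqn v.
Proof. by rewrite /sqn mulr_sumr; apply: eq_bigr => i _; rewrite mxE exprMn. Qed.

Lemma sqnN k (v : 'cV[R]_k) : sqn (- v) = sqn v.
Proof. by apply: eq_bigr => i _; rewrite mxE sqrrN. Qed.

Lemma sqn0 k : sqn (0 : 'cV[R]_k) = 0.
Proof. by apply: big1 => i _; rewrite mxE expr0n. Qed.

Lemma dotvv k (v : 'cV[R]_k) : dotv v v = sqn v.
Proof. by apply: eq_bigr => i _; rewrite expr2. Qed.

Lemma dotvDr k (u v w : 'cV[R]_k) : dotv u (v + w) = dotv u v + dotv u w.
Proof. by rewrite /dotv -big_split; apply: eq_bigr => i _; rewrite mxE mulrDr. Qed.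

Lemma dotvZr k c (u v : 'cV[R]_k) : dotv u (c *: v) = c * dotv u v.
Proof. by rewrite /dotv mulr_sumr; apply: eq_bigr => i _; rewrite mxE mulrCA. Qed.

Lemma dotvC k (u v : 'cV[R]_k) : dotv u v = dotv v u.
Proof. by apply: eq_bigr => i _; rewrite mulrC. Qed.

Lemma dotvBl k (u v w : 'cV[R]_k) : dotv (u - v) w = dotv u w - dotv v w.
Proof. by rewrite !(dotvC _ w) dotvDr -scaleN1r dotvZr mulN1r. Qed.

Lemma dotv_trmx k l (A : 'M[R]_(k, l)) (u : 'cV[R]_k) (v : 'cV[R]_l) :
  dotv (A^T *m u) v = dotv u (A *m v).
Proof.
rewrite /dotv; under eq_bigr do rewrite mxE mulr_suml.
rewrite exchange_big/=; apply: eq_bigr => i _.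
rewrite mxE mulr_sumr; apply: eq_bigr => j _; rewrite mxE; ring.
Qed.

Lemma sqnD k (u v : 'cV[R]_k) : sqn (u + v) = sqn u + 2 * dotv u v + sqn v.
Proof.
rewrite /sqn /dotv mulr_sumr -!big_split; apply: eq_bigr => i _.
by rewrite mxE /=; ring.
Qed.

Lemma sqnB k (u v : 'cV[R]_k) : sqn (u - v) = sqn u - 2 * dotv u v + sqn v.
Proof. by rewrite sqnD sqnN -scaleN1r dotvZr; ring. Qed.

Lemma young_dotv k (c : R) (u v : 'cV[R]_k) : 0 < c ->
  2 * dotv u v <= c * sqn u + c^-1 * sqn v.
Proof.
move=> c0; have := sqn_ge0 (c *: u - v).
rewrite sqnB sqnZ (dotvC _ v) dotvZr (dotvC v) => h.
rewrite -subr_ge0 -(pmulr_rge0 _ c0).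
rewrite [X in 0 <= X](_ : _ = c ^+ 2 * sqn u - 2 * (c * dotv u v) + sqn v)//.
by field; rewrite gt_eqF.
Qed.

Lemma cauchy_schwarz k (u v : 'cV[R]_k) : dotv u v ^+ 2 <= sqn u * sqn v.
Proof.
have [v0|v0] := eqVneq (sqn v) 0.
  suff -> : dotv u v = 0 by rewrite expr0n mulr_ge0 ?sqn_ge0.
  apply: big1 => i _; suff /eqP -> : v i 0 == 0 by rewrite mulr0.
  have /psumr_eq0P : sqn v = 0 by [].
  by move=> /(_ (fun _ _ => sqr_ge0 _) i isT)/eqP; rewrite sqrf_eq0.
have vp : 0 < sqn v by rewrite lt_neqAle eq_sym v0 sqn_ge0.
have := sqn_ge0 (sqn v *: u - dotv u v *: v).
rewrite sqnB !sqnZ dotvZr (dotvC (_ *: u)) dotvZr (dotvC v).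
rewrite [X in 0 <= X](_ : _ = sqn v * (sqn u * sqn v - dotv u v ^+ 2)); last by ring.
by rewrite pmulr_rge0// subr_ge0.
Qed.

Lemma dotv_le k (u v : 'cV[R]_k) : dotv u v <= enorm u * enorm v.
Proof.
rewrite (le_trans (ler_norm _))// -ler_sqr ?nnegrE ?mulr_ge0 ?enorm_ge0//.
by rewrite exprMn !sqr_enorm -normrX ger0_norm ?sqr_ge0// cauchy_schwarz.
Qed.

Lemma sqnD_le2 k (u v : 'cV[R]_k) : sqn (u + v) <= 2 * sqn u + 2 * sqn v.
Proof.
have := @young_dotv _ 1 u v ltr01; rewrite sqnD invr1; lra.
Qed.

Lemma sqnB_le2 k (u v : 'cV[R]_k) : sqn (u - v) <= 2 * sqn u + 2 * sqn v.
Proof. by rewrite -(sqnN v) sqnD_le2. Qed.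

(* With [u = x_t - x_tau], [q = t - tau] and [v] the next increment, this says that
   [sqn (x_t - x_tau) / (t - tau)] grows by at most [sqn v] per step. *)
Lemma sqnD_le_nat k (u v : 'cV[R]_k) (q : nat) (Q : R) :
  0 <= Q -> sqn u <= q%:R * Q -> sqn (u + v) <= q.+1%:R * (Q + sqn v).
Proof.
move=> Q0 uQ; rewrite sqnD -[q.+1%:R]natr1; have v0 := sqn_ge0 v.
case: q uQ => [|q] uQ.
  have u0 : sqn u = 0 by apply/eqP; rewrite eq_le sqn_ge0 andbT -(mul0r Q).
  have := cauchy_schwarz u v; rewrite u0 mul0r => /[dup].
  rewrite le_eqVlt ltNge sqr_ge0 orbF sqrf_eq0 => /eqP -> _; lra.
have q0 : 0 < q.+1%:R :> R by rewrite ltr0n.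
move: (q.+1%:R : R) uQ q0 => c uQ q0.
(* This weight is the one with [(1 + c^-1) * c = c + 1]. It does not exist at age 0, a case settled
   above because [u] then has norm 0. *)
have /(@young_dotv _ _ u v) : 0 < c^-1 by rewrite invr_gt0.
rewrite invrK.
have : c^-1 * sqn u <= Q by rewrite ler_pdivrMl.
move: (c^-1 * sqn u) => e; lra.
Qed.

(** Jensen for the squared norm: with M the mean, sum the inequalities 2<M, X_i> <= |M|^2 +
    |X_i|^2. *)
Lemma sqn_mean_le k (J : finType) (S : {pred J}) (X : J -> 'cV[R]_k) (c : R) :
  #|S|%:R = c -> 0 < c ->
  sqn (c^-1 *: \sum_(i in S) X i) <= c^-1 * \sum_(i in S) sqn (X i).
Proof.
move=> Sc c0; pose M : 'cV[R]_k := c^-1 *: \sum_(i in S) X i.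
suff : 2 * c * sqn M <= c * sqn M + \sum_(i in S) sqn (X i).
  rewrite -/M ler_pdivlMl//; lra.
have {1}-> : 2 * c * sqn M = \sum_(i in S) 2 * dotv M (X i).
  rewrite -mulr_sumr -mulrA -dotvv -dotvZr scalerA mulfV ?gt_eqF// scale1r.
  congr (_ * _); apply: (big_ind2 (fun x y => dotv M x = y)) => //.
    by apply: big1 => i _; rewrite [X in _ * X]mxE mulr0.
  by move=> x1 x2 y1 y2 <- <-; rewrite dotvDr.
rewrite -Sc mulr_natl -sumr_const -big_split/=; apply: ler_sum => i _.
by have := @young_dotv _ 1 M (X i) ltr01; rewrite invr1 !mul1r.
Qed.

End SquaredNorm.

(** * Derivatives and Lipschitz bounds *)

Section Calculus.
Context {R : realType}.
Import numFieldNormedType.Exports.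
Local Open Scope classical_set_scope.

Lemma dotv_is_linear k (a : 'cV[R]_k) : linear (dotv a : 'cV[R]_k -> R^o).
Proof. by move=> c u v; rewrite dotvDr dotvZr. Qed.

HB.instance Definition _ k (a : 'cV[R]_k) :=
  GRing.isLinear.Build R 'cV[R]_k R^o _ (dotv a : 'cV[R]_k -> R^o) (dotv_is_linear a).

Lemma dotv_continuous k (a : 'cV[R]_k) : continuous (dotv a : 'cV[R]_k -> R^o).
Proof.
move=> x; apply: (@differentiable_continuous R _ R^o).
rewrite (_ : dotv a = \sum_(i < k) (fun w : 'cV[R]_k => a i 0 *: (w i 0 : R^o))).
  apply: (@differentiable_sum R 'cV[R]_k R^o) => i.
  by apply: (@differentiableZ R 'cV[R]_k R^o); exact: differentiable_coord.
by apply/funext => w; rewrite fct_sumE.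
Qed.

Lemma diff_dotv k l (a : 'cV[R]_l) (g : 'cV[R]_k -> 'cV[R]_l) x h :
  differentiable g x ->
  differentiable (fun w => dotv a (g w) : R^o) x /\
  'd (fun w => dotv a (g w) : R^o) x h = dotv a ('d g x h).
Proof.
move=> gx.
have da y : differentiable (dotv a : 'cV[R]_l -> R^o) y.
  exact/linear_differentiable/dotv_continuous.
split; first exact: (@differentiable_comp R _ _ R^o g (dotv a)).
rewrite (@diff_comp R _ _ R^o g (dotv a))//= diff_lin//.
exact: dotv_continuous.
Qed.

Lemma diff_norm_le k (f : 'cV[R]_k -> R^o) x h C : differentiable f x ->
  (forall s : R, `|f (s *: h + x) - f x| <= C * `|s|) -> `|'d f x h| <= C.
Proof.
move=> fx fC; rewrite -deriveE//.
have fc : (fun s : R => s^-1 *: ((f \o shift x) (s *: h) - f x)) @ 0^' --> 'D_h f x.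
  exact: diff_derivable.
apply: (cvgr_to_le (cvg_norm fc)).
near=> s; rewrite normrM normfV ler_pdivrMl ?normr_gt0; last first.
  by near: s; exact: nbhs_dnbhs_neq.
by rewrite mulrC; exact: fC.
Unshelve. all: by end_near. Qed.

Lemma line_mean_value k (f : 'cV[R]_k -> R^o) x h :
  (forall w, differentiable f w) ->
  exists2 s : R, 0 <= s <= 1 & f (x + h) - f x = 'd f (s *: h + x) h.
Proof.
move=> fd; pose phi (s : R) : R^o := f (s *: h + x).
have dphi (s : R) : is_derive s 1 phi ('d f (s *: h + x) h).
  have dl : is_diff s (fun t : R => t *: h + x) (fun t => t *: h).
    by have := is_diffD (is_diff_scalel s h) (is_diff_cst x s); rewrite addr0.
  have dfl : is_diff s phi ('d f (s *: h + x) \o (fun t => t *: h)).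
    by apply: (@is_diff_comp R R _ R^o); apply: DiffDef.
  apply: DeriveDef; first by apply: diff_derivable; apply: ex_diff.
  by rewrite deriveE ?diff_val/= ?scale1r//; apply: ex_diff.
have phic : {within `[0, 1 : R], continuous phi}.
  apply: continuous_subspaceT => s; apply: differentiable_continuous.
  by apply/derivable1_diffP; case: (dphi s).
have [s s01] := MVT_segment ler01 (fun s _ => dphi s) phic.
rewrite /phi scale1r scale0r add0r subr0 mulr1 addrC [h + x]addrC => E.
by exists s => //; rewrite -E addrC.
Qed.

End Calculus.

Section Smoothness.
Context {R : realType}.
Import numFieldNormedType.Exports.
Implicit Types k l : nat.

Lemma dotv_eq k (a b : 'cV[R]_k) : (forall h, dotv a h = dotv b h) -> a = b.
Proof.
move=> ab; apply/eqP; rewrite -subr_eq0; apply/eqP.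
have := dotvBl a b (a - b); rewrite ab subrr dotvv => /psumr_eq0P s0.
apply/colP => i; rewrite [RHS]mxE; apply/eqP; rewrite -sqrf_eq0.
by apply/eqP; apply: s0 => // j _; exact: sqr_ge0.
Qed.

Lemma enormZ k c (v : 'cV[R]_k) : enorm (c *: v) = `|c| * enorm v.
Proof.
by rewrite /enorm -[X in Num.sqrt X]/(sqn _) sqnZ sqrtrM ?sqr_ge0// sqrtr_sqr.
Qed.

(** In the direction [g u] the derivative is the squared norm of [g u], while the Lipschitz bound
    caps it by [C] times the norm. *)
Lemma grad_bound k (f : 'cV[R]_k -> R) (g : 'cV[R]_k -> 'cV[R]_k) C :
  0 <= C ->
  (forall u, differentiable (f : _ -> R^o) u /\
     forall h, 'd (f : _ -> R^o) u h = dotv (g u) h) ->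
  (forall u v, `|f u - f v| <= C * enorm (u - v)) ->
  forall u, sqn (g u) <= C ^+ 2.
Proof.
move=> C0 fg fC u; have [fu du] := fg u.
have : `|'d (f : _ -> R^o) u (g u)| <= C * enorm (g u).
  apply: diff_norm_le => // s; rewrite (le_trans (fC _ _))//.
  by rewrite addrK enormZ mulrCA mulrC.
rewrite du dotvv ger0_norm ?sqn_ge0// -{1}sqr_enorm expr2.
rewrite -sqr_enorm_le//; have := enorm_ge0 (g u).
by rewrite le_eqVlt => /predU1P[<-//|g0]; rewrite ler_pM2r.
Qed.

(** The scalar function [dotv v (g w)] is differentiated in the direction [(J u)^T *m v]. A
    Lipschitz constant controls the operator norm of the Jacobian and not its Frobenius norm, hence
    the form of the conclusion. *)
Lemma jacobian_bound k l (g : 'cV[R]_k -> 'cV[R]_l) (J : 'cV[R]_k -> 'M[R]_(l, k)) C :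
  0 <= C ->
  (forall u, differentiable g u /\ forall h, 'd g u h = J u *m h) ->
  (forall u v, enorm (g u - g v) <= C * enorm (u - v)) ->
  forall u v, sqn ((J u)^T *m v) <= C ^+ 2 * sqn v.
Proof.
move=> C0 gJ gC u v; have [gu du] := gJ u.
set h := (J u)^T *m v.
have [dg dgE] := diff_dotv v h gu.
have : `|'d (fun w => dotv v (g w) : R^o) u h| <= C * enorm v * enorm h.
  apply: diff_norm_le => // s.
  have dle w : `|dotv v w| <= enorm v * enorm w.
    rewrite ler_norml dotv_le andbT lerNl -mulN1r -dotvZr (le_trans (dotv_le _ _))//.
    by rewrite enormZ normrN1 mul1r.
  rewrite dotvC (dotvC v (g u)) -dotvBl dotvC (le_trans (dle _))//.
  rewrite (_ : _ * `|s| = enorm v * (C * (`|s| * enorm h))); last by ring.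
  by rewrite ler_wpM2l ?enorm_ge0// (le_trans (gC _ _))// addrK enormZ.
rewrite dgE du -dotv_trmx -/h dotvv ger0_norm ?sqn_ge0// -{1}sqr_enorm expr2.
move=> hh; have hle : enorm h <= C * enorm v.
  have := enorm_ge0 h; rewrite le_eqVlt => /predU1P[<-|h0].
    by rewrite mulr_ge0 ?enorm_ge0.
  by rewrite ler_pM2r in hh.
by rewrite -(sqr_enorm v) -exprMn -sqr_enorm_le ?mulr_ge0 ?enorm_ge0.
Qed.

(** The mean value theorem compares the gradient at [x] with one intermediate point, which avoids an
    integral and yields [L] instead of the sharp L/2. *)
Lemma descent k (F : 'cV[R]_k -> R) (g : 'cV[R]_k -> 'cV[R]_k) L :
  0 <= L ->
  (forall u, differentiable (F : _ -> R^o) u /\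
     forall h, 'd (F : _ -> R^o) u h = dotv (g u) h) ->
  (forall u v, enorm (g u - g v) <= L * enorm (u - v)) ->
  forall x h, F (x + h) <= F x + dotv (g x) h + L * sqn h.
Proof.
move=> L0 Fg gL x h.
have [s /andP[s0 s1]] := @line_mean_value R _ F x h (fun w => (Fg w).1).
rewrite (Fg _).2 => E.
have : dotv (g (s *: h + x) - g x) h <= L * sqn h.
  rewrite (le_trans (dotv_le _ _))// -sqr_enorm expr2 mulrA ler_wpM2r ?enorm_ge0//.
  rewrite (le_trans (gL _ _))// addrK enormZ ler_wpM2l// ger0_norm//.
  by rewrite ler_piMl ?enorm_ge0.
rewrite dotvBl -E; lra.
Qed.

Lemma sqn_mulmx_tr k l (A : 'M[R]_(l, k)) v : sqn (A^T *m v) <= sqf A * sqn v.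
Proof.
rewrite /sqf exchange_big/= mulr_suml; apply: ler_sum => j _.
have := cauchy_schwarz (col j A) v.
rewrite (_ : dotv _ v = (A^T *m v) j 0); last first.
  by rewrite mxE; apply: eq_bigr => i _; rewrite !mxE.
move=> /le_trans; apply.
by rewrite [sqn (col _ _)](eq_bigr (fun i => A i j ^+ 2)) => [|i _]; rewrite ?mxE.
Qed.

End Smoothness.

(** * One iteration *)

(** Bias and variance: the centred noise is uncorrelated with the constant [c], and a variance is at
    most the second moment. Later bounds thus need only second moments of uncentred mini-batch
    differences. *)
Lemma avg_sqn_shift_le {R : realType} (T : finType) (P : pred T) k
    (X : T -> 'cV[R]_k) (c mu : 'cV[R]_k) x0 : P x0 ->
  (forall i, avg P (fun x => X x i 0) = mu i 0) ->
  avg P (fun x => sqn (c + (X x - mu))) <= sqn c + avg P (fun x => sqn (X x)).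
Proof.
move=> Px0 Xmu; rewrite /sqn !avg_sum -big_split; apply: ler_sum => i _ /=.
rewrite (@eq_avg _ _ _ _ (fun x =>
    (c i 0 - mu i 0) ^+ 2 + 2 * (c i 0 - mu i 0) * X x i 0 + X x i 0 ^+ 2)); last first.
  by move=> x _; rewrite !mxE; ring.
rewrite !avgD avgZ Xmu (avg_cst _ Px0); have := sqr_ge0 (mu i 0).
by move: (avg P _) => A; lra.
Qed.

Section Sampling.
Context {R : realType}.
Variables (m n B1 B2 : nat).
Hypotheses (B1_gt0 : (0 < B1)%N) (B1m : (B1 <= m)%N).
Hypotheses (B2_gt0 : (0 < B2)%N) (B2n : (B2 <= n)%N).

Lemma valid_sample_exists : exists s : sample m n, valid_sample B1 B2 s.
Proof.
have [S SB] := draw_exists B1m; have [x xB] := draw_exists B2n.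
exists (S, [ffun=> x]); rewrite /valid_sample SB/=.
by apply/forallP => i; rewrite ffunE.
Qed.

Lemma avg_block_if i (q : {set 'I_n} -> R) c :
  avg (valid_sample B1 B2) (fun s : sample m n => if i \in s.1 then q (s.2 i) else c) =
  B1%:R / m%:R * Ebatch B2 q + (1 - B1%:R / m%:R) * c.
Proof.
have [S SB] := draw_exists B1m; have [x xB] := draw_exists B2n.
(* The indicator form is a product of a function of the block batch and a function of the inner
   batches, which are independent. *)
rewrite (@eq_avg _ _ _ _
    (fun s : sample m n => (i \in s.1)%:R * (q (s.2 i) - c) + c)); last first.
  by move=> s _; case: (i \in s.1); rewrite ?mul1r ?subrK ?mul0r ?add0r.
have [s0 s0B] := valid_sample_exists.
rewrite avgD (avg_cst _ s0B).
rewrite (@avg_prod R _ _ (fun S : {set 'I_m} => #|S| == B1)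
  (fun f : {ffun 'I_m -> {set 'I_n}} => [forall i, #|f i| == B2])
  (fun S => (i \in S)%:R) (fun f => q (f i) - c)).
rewrite avg_draw_mem//.
rewrite (@avg_ffun_coord R _ _ (fun x : {set 'I_n} => #|x| == B2) i (fun x => q x - c) x)//.
rewrite avgB (@avg_cst R _ (fun x : {set 'I_n} => #|x| == B2) _ x)// -[Ebatch _ _]/(avg _ _).
ring.
Qed.

Lemma avg_block_mean (q : 'I_m -> {set 'I_n} -> R) :
  avg (valid_sample B1 B2)
    (fun s : sample m n => B1%:R^-1 * \sum_(i in s.1) q i (s.2 i)) =
  m%:R^-1 * \sum_i Ebatch B2 (q i).
Proof.
rewrite avgZ; under eq_avg do rewrite big_mkcond/=.
rewrite avg_sum.
under eq_bigr do rewrite avg_block_if mulr0 addr0.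
rewrite -mulr_sumr !mulrA mulVf ?mul1r//.
by rewrite pnatr_eq0 -lt0n.
Qed.

Lemma avg_block_mean_sqn_le k (X : 'I_m -> {set 'I_n} -> 'cV[R]_k) :
  avg (valid_sample B1 B2)
    (fun s : sample m n => sqn (B1%:R^-1 *: \sum_(i in s.1) X i (s.2 i))) <=
  m%:R^-1 * \sum_i Ebatch B2 (fun xi => sqn (X i xi)).
Proof.
rewrite -avg_block_mean; apply: ler_avg => s /andP[/eqP sB _].
by apply: sqn_mean_le; rewrite ?sB// ltr0n.
Qed.

Lemma avg_batch_mean k l (x : 'I_n -> 'M[R]_(k, l)) i j :
  Ebatch B2 (fun xi => (B2%:R^-1 *: \sum_(r in xi) x r) i j) =
  (n%:R^-1 *: \sum_r x r) i j.
Proof.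
rewrite -[LHS]/(avg _ _).
under eq_avg do rewrite mxE summxE.
by rewrite avg_draw_sum// mxE summxE.
Qed.

End Sampling.

Section OneStep.
Context {R : realType}.
Variables (d p m n : nat).
Variable gs : 'I_m -> 'I_n -> 'cV[R]_d -> 'cV[R]_p.
Variable Jg : 'I_m -> 'I_n -> 'cV[R]_d -> 'M[R]_(p, d).
Variable gradf : 'I_m -> 'cV[R]_p -> 'cV[R]_p.
Variables (B1 B2 I : nat) (alpha beta eta : R).
Hypotheses (B1_gt0 : (0 < B1)%N) (B1m : (B1 <= m)%N).
Hypotheses (B2_gt0 : (0 < B2)%N) (B2n : (B2 <= n)%N).
Hypotheses (alpha01 : 0 <= alpha <= 1) (beta_half : 0 <= beta <= 1 / 2).
Variables Lf Cf Lg Cg sigma : R.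
Hypothesis f_lip : forall i u, sqn (gradf i u) <= Cf ^+ 2.
Hypothesis f_smooth : forall i u v,
  sqn (gradf i u - gradf i v) <= Lf ^+ 2 * sqn (u - v).
Hypothesis g_lip : forall i x y,
  sqn (gfull gs i x - gfull gs i y) <= Cg ^+ 2 * sqn (x - y).
Hypothesis J_bound : forall i x v, sqn ((Jfull Jg i x)^T *m v) <= Cg ^+ 2 * sqn v.
Hypothesis J_var : forall i x,
  Ebatch B2 (fun xi => sqf (JB Jg B2 i xi x - Jfull Jg i x)) <= sigma ^+ 2.
Hypothesis gB_lip : forall i x y,
  Ebatch B2 (fun xi => sqn (gB gs B2 i xi x - gB gs B2 i xi y)) <=
  Cg ^+ 2 * sqn (x - y).
Hypothesis JB_lip : forall i x y,
  Ebatch B2 (fun xi => sqf (JB Jg B2 i xi x - JB Jg B2 i xi y)) <=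
  Lg ^+ 2 * sqn (x - y).

Local Notation sample := (sample m n).
Local Notation state := (state R d p m).
Local Notation Es := (avg (@valid_sample m n B1 B2)).
Local Notation pa := (B1%:R / m%:R : R).
Local Notation g := (gfull gs).
Local Notation step := (step gs Jg gradf B1 B2 I alpha beta eta).
Local Notation G := (Gi Jg gradf B2).

Definition Gbar (w : 'cV[R]_d) (u : 'I_m -> 'cV[R]_p) : 'cV[R]_d :=
  m%:R^-1 *: \sum_i ((Jfull Jg i w)^T *m gradf i (u i)).
Definition msq (u v : 'I_m -> 'cV[R]_p) : R := m%:R^-1 * \sum_i sqn (u i - v i).

Definition Uerr (s : state) : R := msq (u_cur s) (fun i => g i (w_cur s)).
Definition Vinc (s : state) : R := msq (u_cur s) (u_prev s).
(** Looks forward to w_{t+1}, already determined by the state of iteration t, whereas [Vinc] looks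
    back. *)
Definition Winc (s : state) : R := sqn (w_next s - w_cur s).
Definition Wanc (s : state) : R := sqn (w_cur s - w_tau s).
Definition Yanc (s : state) : R := msq (u_prev s) (u_tau s).
(** The target is taken at [u_prev] because iteration t evaluates gradients at u_{t-1}. It is
    therefore fixed before the sample is drawn, and h_t is unbiased for it. *)
Definition Zerr (s : state) : R := sqn (z_cur s - Gbar (w_cur s) (u_prev s)).

(** The anchor in force during step [t]. It becomes [w_tau] of the new state whatever the sample, so
    its distance to [w_next s] is convertible to [Wanc] of the new state; likewise [uanchor] and
    [Yanc]. *)
Definition wanchor t (s : state) := if (t %% I == 0)%N then w_next s else w_tau s.
Definition uanchor t (s : state) := if (t %% I == 0)%N then u_cur s else u_tau s.

Lemma m_gt0 : 0 < m%:R :> R.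
Proof. by rewrite ltr0n (leq_trans B1_gt0). Qed.

Lemma pa_gt0 : 0 < pa.
Proof. by rewrite divr_gt0 ?m_gt0// ltr0n. Qed.

Lemma pa_le1 : pa <= 1.
Proof. by rewrite ler_pdivrMr ?m_gt0// mul1r ler_nat. Qed.

Lemma Ebatch_cst (c : R) : Ebatch B2 (fun _ : {set 'I_n} => c) = c.
Proof.
have [x xB] := draw_exists B2n.
exact: (@avg_cst R _ (fun S : {set 'I_n} => #|S| == B2) _ x).
Qed.

Lemma EbatchD (X Y : {set 'I_n} -> R) :
  Ebatch B2 (fun xi => X xi + Y xi) = Ebatch B2 X + Ebatch B2 Y.
Proof. exact: avgD. Qed.

Lemma EbatchZ c (X : {set 'I_n} -> R) :
  Ebatch B2 (fun xi => c * X xi) = c * Ebatch B2 X.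
Proof. exact: avgZ. Qed.

Lemma Ebatch_le (X Y : {set 'I_n} -> R) :
  (forall xi, X xi <= Y xi) -> Ebatch B2 X <= Ebatch B2 Y.
Proof. by move=> XY; apply: ler_avg. Qed.

Section Gamma.
Local Notation gam := (Defs.gamma m B1 beta).

Lemma gamma_eq : gam - (1 - beta) = (1 - pa) / (pa * (1 - beta)).
Proof.
rewrite /gamma addrK natrB//.
have b1 : 1 - beta != 0 by case/andP: beta_half => *; lra.
field; rewrite b1 !pnatr_eq0 -!lt0n B1_gt0 (leq_trans B1_gt0 B1m)//.
Qed.

(** With [beta] at most 1/2, [1 / (1 - beta)] is at most 2, which leaves [gam] of order 1/a: a block
    is drawn about once in 1/a iterations and must then make up for the increments it missed. *)
Lemma gamma_bound : [/\ 0 <= gam - (1 - beta), gam - (1 - beta) <= 2 / pa &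
  gam <= 2 / pa].
Proof.
have := pa_gt0; have := pa_le1; have := gamma_eq; move: (pa) => a.
case/andP: beta_half => b0 b2 gE a1 a0; have b1 : 0 < 1 - beta by lra.
have ab0 : 0 < a * (1 - beta) by rewrite mulr_gt0.
rewrite gE -[in X in [/\ _, _ & X]](subrK (1 - beta) gam) gE; split.
- by rewrite divr_ge0 ?subr_ge0// ltW.
- rewrite ler_pdivrMr// mulrA divfK ?gt_eqF//; nra.
- rewrite -[X in _ + X](mulfK (lt0r_neq0 ab0)) -mulrDl ler_pdivrMr//.
  rewrite [X in _ <= X]mulrA divfK ?gt_eqF//; nra.
Qed.

(** The random part of a drawn block's update. It consists of mini-batch differences only, so (A3)
    bounds its second moment by squared displacements; the rest of the update is deterministic. *)
Definition Xu wn wa wc i xi : 'cV[R]_p :=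
  beta *: (gB gs B2 i xi wn - gB gs B2 i xi wa) +
  gam *: (gB gs B2 i xi wn - gB gs B2 i xi wc).

Lemma Xu_sqn_le wn wa wc i :
  Ebatch B2 (fun xi => sqn (Xu wn wa wc i xi)) <=
  2 * beta ^+ 2 * Cg ^+ 2 * sqn (wn - wa) + 2 * gam ^+ 2 * Cg ^+ 2 * sqn (wn - wc).
Proof.
apply: (@le_trans _ _ (Ebatch B2 (fun xi =>
  (2 * beta ^+ 2) * sqn (gB gs B2 i xi wn - gB gs B2 i xi wa) +
  (2 * gam ^+ 2) * sqn (gB gs B2 i xi wn - gB gs B2 i xi wc)))).
  apply: Ebatch_le => xi.
  have := sqnD_le2 (beta *: (gB gs B2 i xi wn - gB gs B2 i xi wa))
    (gam *: (gB gs B2 i xi wn - gB gs B2 i xi wc)).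
  by rewrite !sqnZ !(mulrA 2).
rewrite EbatchD !EbatchZ -![_ * Cg ^+ 2 * _]mulrA.
have b2 := sqr_ge0 beta; have g2 := sqr_ge0 gam.
by apply: lerD; (apply: ler_wpM2l; [lra|exact: gB_lip]).
Qed.

(* [kap] makes the coefficient of [dotv e D] vanish: the blocks that are not drawn
   contribute [- 2 (1 - pa)], the drawn ones [2 pa (1 - beta) kap]. *)
Lemma avg_Uerr_block wn wa wc (u : 'cV[R]_p) i :
  Es (fun s : sample => sqn ((if i \in s.1 then
       (1 - beta) *: u
       + beta *: (gB gs B2 i (s.2 i) wn - gB gs B2 i (s.2 i) wa + g i wa)
       + gam *: (gB gs B2 i (s.2 i) wn - gB gs B2 i (s.2 i) wc) else u) - g i wn)) <=
  (1 - pa * beta) * sqn (u - g i wc) + 2 * pa * beta ^+ 2 * Cg ^+ 2 * sqn (wn - wa)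
  + 13 / pa * Cg ^+ 2 * sqn (wn - wc).
Proof.
pose e := u - g i wc; pose D := g i wn - g i wc.
pose kap := gam - (1 - beta).
pose mu := beta *: (g i wn - g i wa) + gam *: (g i wn - g i wc).
pose c := (1 - beta) *: e + kap *: D.
rewrite (@eq_avg _ _ _ _ (fun s : sample => if i \in s.1 then
    sqn (c + (Xu wn wa wc i (s.2 i) - mu)) else sqn (e - D))); last first.
  move=> s _; case: (i \in s.1); congr sqn.
    by rewrite /c /mu /kap /e /D /Xu; apply/colP => k; rewrite !mxE; ring.
  by rewrite /e /D; apply/colP => k; rewrite !mxE; ring.
rewrite (@avg_block_if R m n B1 B2 B1m B2n i
  (fun xi => sqn (c + (Xu wn wa wc i xi - mu)))).
have [x xB] := draw_exists B2n.
have XE : Ebatch B2 (fun xi => sqn (c + (Xu wn wa wc i xi - mu))) <=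
    sqn c + Ebatch B2 (fun xi => sqn (Xu wn wa wc i xi)).
  apply: (@avg_sqn_shift_le R _ (fun S : {set 'I_n} => #|S| == B2) _ _ _ _ x) => // k.
  rewrite (@eq_avg _ _ _ _ (fun xi =>
     beta * (gB gs B2 i xi wn k 0 - gB gs B2 i xi wa k 0)
     + gam * (gB gs B2 i xi wn k 0 - gB gs B2 i xi wc k 0))); last first.
    by move=> xi _; rewrite !mxE.
  rewrite avgD !avgZ !avgB.
  have gBm w : avg (fun S : {set 'I_n} => #|S| == B2) (fun xi => gB gs B2 i xi w k 0)
    = g i w k 0 by exact: (@avg_batch_mean R n B2 B2_gt0 B2n).
  by rewrite !gBm !mxE.
have Xle := Xu_sqn_le wn wa wc i.
have Dle : sqn D <= Cg ^+ 2 * sqn (wn - wc) by exact: g_lip.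
have dE : sqn c = (1 - beta) ^+ 2 * sqn e + 2 * ((1 - beta) * kap) * dotv e D
    + kap ^+ 2 * sqn D.
  by rewrite /c sqnD !sqnZ dotvZr (dotvC _ D) dotvZr (dotvC D); ring.
have eD : sqn (e - D) = sqn e - 2 * dotv e D + sqn D by exact: sqnB.
have kE : pa * ((1 - beta) * kap) = 1 - pa.
  rewrite /kap gamma_eq.
  have b1 : 1 - beta != 0 by case/andP: beta_half => *; lra.
  rewrite mulrA [X in _ * (_ / X)]mulrC; field.
  by rewrite b1 !pnatr_eq0 -!lt0n B1_gt0 (leq_trans B1_gt0 B1m).
have [k0 k1 gle] := gamma_bound; rewrite -/kap in k0 k1.
have g0 : 0 <= gam.
  by rewrite -(subrK (1 - beta) gam) addr_ge0//; case/andP: beta_half => *; lra.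
have := pa_gt0; have := pa_le1.
move: kE k1 gle; move: (pa) => a kE k1 gle a1 a0.
have a_neq0 : a != 0 by rewrite gt_eqF.
have a2 : 0 <= 2 / a by rewrite divr_ge0 ?ler0n// ltW.
have k2 : a * kap ^+ 2 <= 4 / a.
  have : kap ^+ 2 <= (2 / a) ^+ 2 by rewrite ler_sqr ?nnegrE.
  move=> /(ler_wpM2l (ltW a0)) /le_trans; apply.
  by rewrite le_eqVlt; apply/orP; left; apply/eqP; field.
have g2 : a * gam ^+ 2 <= 4 / a.
  have : gam ^+ 2 <= (2 / a) ^+ 2 by rewrite ler_sqr ?nnegrE.
  move=> /(ler_wpM2l (ltW a0)) /le_trans; apply.
  by rewrite le_eqVlt; apply/orP; left; apply/eqP; field.
have a1' : 1 - a <= 1 / a by rewrite ler_pdivlMr//; nra.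
have aXE := ler_wpM2l (ltW a0) (le_trans XE (lerD (lexx (sqn c)) Xle)).
set E0 := Ebatch _ _ in aXE *.
have e0 := sqn_ge0 e; have D0 := sqn_ge0 D.
have dw0 := sqn_ge0 (wn - wc); have C0 := sqr_ge0 Cg.
rewrite -/e; apply: (@le_trans _ _ (a * (sqn c + (2 * beta ^+ 2 * Cg ^+ 2 * sqn (wn - wa)
   + 2 * gam ^+ 2 * Cg ^+ 2 * sqn (wn - wc))) + (1 - a) * sqn (e - D))).
  by rewrite lerD2r.
rewrite dE eD.
(* Origin of 13: the bias term in [D] gives [5 / a], the sum of [4 / a] from drawn blocks and at
   most [1 / a] from the others; the second moment of the [gam] term adds [8 / a] in [h2]. *)
have h1 : (a * kap ^+ 2 + (1 - a)) * sqn D <= 5 / a * (Cg ^+ 2 * sqn (wn - wc)).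
  have ak := mulr_ge0 (ltW a0) (sqr_ge0 kap).
  by apply: ler_pM => //; lra.
have h2 : 2 * (a * gam ^+ 2) * (Cg ^+ 2 * sqn (wn - wc)) <= 8 / a * (Cg ^+ 2 * sqn (wn - wc)).
  by apply: ler_wpM2r; [exact: mulr_ge0|lra].
have h3 : (a * (1 - beta) ^+ 2 + (1 - a)) * sqn e <= (1 - a * beta) * sqn e.
  rewrite ler_wpM2r//; case/andP: beta_half => b0 b2; nra.
rewrite [X in X <= _](_ : _ = (a * (1 - beta) ^+ 2 + (1 - a)) * sqn e
   + (a * kap ^+ 2 + (1 - a)) * sqn D
   + 2 * (a * gam ^+ 2) * (Cg ^+ 2 * sqn (wn - wc))
   + 2 * a * beta ^+ 2 * Cg ^+ 2 * sqn (wn - wa)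
   + 2 * (a * ((1 - beta) * kap) - (1 - a)) * dotv e D); last by ring.
rewrite kE subrr mulr0 mul0r addr0; lra.
Qed.


(** Blocks that are not drawn do not move, which is the source of the factor [pa]; a drawn block
    feels its old error only through [beta]. *)
Lemma avg_Vinc_block wn wa wc (u : 'cV[R]_p) i :
  Es (fun s : sample => sqn ((if i \in s.1 then
       (1 - beta) *: u
       + beta *: (gB gs B2 i (s.2 i) wn - gB gs B2 i (s.2 i) wa + g i wa)
       + gam *: (gB gs B2 i (s.2 i) wn - gB gs B2 i (s.2 i) wc) else u) - u)) <=
  8 * pa * beta ^+ 2 * sqn (u - g i wc) + 8 * pa * beta ^+ 2 * Cg ^+ 2 * sqn (wn - wa)
  + 18 / pa * Cg ^+ 2 * sqn (wn - wc).
Proof.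
(* This is [beta *: (g i wa - u)], spelled out to display two displacements and the old error. *)
pose r := beta *: ((g i wa - g i wn) + ((g i wn - g i wc) - (u - g i wc))).
rewrite (@eq_avg _ _ _ _ (fun s : sample => if i \in s.1 then
    sqn (Xu wn wa wc i (s.2 i) + r) else 0)); last first.
  move=> s _; case: (i \in s.1); last by rewrite subrr sqn0.
  by congr sqn; rewrite /r /Xu; apply/colP => k; rewrite !mxE; ring.
rewrite (@avg_block_if R m n B1 B2 B1m B2n i
  (fun xi => sqn (Xu wn wa wc i xi + r))) mulr0 addr0.
have XE : Ebatch B2 (fun xi => sqn (Xu wn wa wc i xi + r)) <=
    2 * Ebatch B2 (fun xi => sqn (Xu wn wa wc i xi)) + 2 * sqn r.
  rewrite -[2 * sqn r]Ebatch_cst -EbatchZ -EbatchD.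
  by apply: Ebatch_le => xi; exact: sqnD_le2.
have rle : sqn r <= beta ^+ 2 * (2 * (Cg ^+ 2 * sqn (wn - wa))
    + 4 * (Cg ^+ 2 * sqn (wn - wc)) + 4 * sqn (u - g i wc)).
  rewrite sqnZ; apply: ler_wpM2l; first exact: sqr_ge0.
  have h1 := sqnD_le2 (g i wa - g i wn) ((g i wn - g i wc) - (u - g i wc)).
  have h2 := sqnB_le2 (g i wn - g i wc) (u - g i wc).
  have h3 := g_lip i wa wn; have h4 := g_lip i wn wc.
  rewrite -(sqnN (wa - wn)) opprB in h3; lra.
have Xle := Xu_sqn_le wn wa wc i.
have [_ _ gle] := gamma_bound.
have g0 : 0 <= gam.
  rewrite -(subrK (1 - beta) gam) addr_ge0//; first by case: gamma_bound.
  by case/andP: beta_half => *; lra.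
have := pa_gt0; have := pa_le1.
move: gle; move: (pa) => a gle a1 a0.
have a_neq0 : a != 0 by rewrite gt_eqF.
have a2 : 0 <= 2 / a by rewrite divr_ge0 ?ler0n// ltW.
have g2 : a * gam ^+ 2 <= 4 / a.
  have : gam ^+ 2 <= (2 / a) ^+ 2 by rewrite ler_sqr ?nnegrE.
  move=> /(ler_wpM2l (ltW a0)) /le_trans; apply.
  by rewrite le_eqVlt; apply/orP; left; apply/eqP; field.
(* Origin of 18: [4 * (a * gam ^+ 2)] is at most [16 / a], and this term adds [2 / a]. *)
have b2 : 8 * a * beta ^+ 2 <= 2 / a.
  rewrite ler_pdivlMr//; case/andP: beta_half => b0 bh.
  have : beta ^+ 2 <= 1 / 4 by nra.
  have : a * a <= 1 by nra.
  have := sqr_ge0 beta; nra.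
have dw0 := mulr_ge0 (sqr_ge0 Cg) (sqn_ge0 (wn - wc)).
have h1 := ler_wpM2r dw0 b2; have h2 := ler_wpM2r dw0 g2.
set E1 := Ebatch _ _ in XE *; set E2 := Ebatch _ _ in XE Xle.
have : E1 <= 2 * (2 * beta ^+ 2 * Cg ^+ 2 * sqn (wn - wa)
    + 2 * gam ^+ 2 * Cg ^+ 2 * sqn (wn - wc)) +
   2 * (beta ^+ 2 * (2 * (Cg ^+ 2 * sqn (wn - wa))
    + 4 * (Cg ^+ 2 * sqn (wn - wc)) + 4 * sqn (u - g i wc))) by lra.
move=> /(ler_wpM2l (ltW a0)) /le_trans; apply.
rewrite -subr_ge0 [X in 0 <= X](_ : _ =
   18 / a * (Cg ^+ 2 * sqn (wn - wc)) - 4 * (a * gam ^+ 2 * (Cg ^+ 2 * sqn (wn - wc)))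
   - 8 * a * beta ^+ 2 * (Cg ^+ 2 * sqn (wn - wc))); last by ring.
lra.
Qed.

End Gamma.

Definition M1 : R := 2 * Lg ^+ 2 * Cf ^+ 2.
Definition M2 : R := 4 * (sigma ^+ 2 + Cg ^+ 2) * Lf ^+ 2.

(** A mini-batch Jacobian is bounded only in mean square, through its deviation from the full
    Jacobian. So the change of [gradf] is split between this deviation, giving [sigma], and the full
    Jacobian, giving [Cg]. *)
Lemma G_lip i x y u v :
  Ebatch B2 (fun xi => sqn (G i x u xi - G i y v xi)) <=
  M1 * sqn (x - y) + M2 * sqn (u - v).
Proof.
have pw xi : sqn (G i x u xi - G i y v xi) <=
    2 * Cf ^+ 2 * sqf (JB Jg B2 i xi x - JB Jg B2 i xi y)
    + 4 * sqn (gradf i u - gradf i v) * sqf (JB Jg B2 i xi y - Jfull Jg i y)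
    + 4 * Cg ^+ 2 * sqn (gradf i u - gradf i v).
  pose A := JB Jg B2 i xi x - JB Jg B2 i xi y.
  pose B := JB Jg B2 i xi y - Jfull Jg i y.
  pose dv := gradf i u - gradf i v.
  have -> : G i x u xi - G i y v xi =
      A^T *m gradf i u + (B^T *m dv + (Jfull Jg i y)^T *m dv).
    rewrite -mulmxDl -raddfD/= subrK /Gi /A /dv raddfB/= mulmxBl mulmxBr.
    by rewrite addrA subrK.
  have h1 := sqnD_le2 (A^T *m gradf i u) (B^T *m dv + (Jfull Jg i y)^T *m dv).
  have h2 := sqnD_le2 (B^T *m dv) ((Jfull Jg i y)^T *m dv).
  have h3 := sqn_mulmx_tr A (gradf i u); have h4 := sqn_mulmx_tr B dv.
  have h5 := J_bound i y dv.
  have h6 := ler_wpM2l (sqf_ge0 A) (f_lip i u).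
  rewrite -/A -/B -/dv; lra.
apply: (le_trans (Ebatch_le pw)).
rewrite !EbatchD !EbatchZ Ebatch_cst.
have h1 := ler_wpM2l (sqr_ge0 Cf) (JB_lip i x y).
have h2 := ler_wpM2l (sqn_ge0 (gradf i u - gradf i v)) (J_var i y).
have h3 := ler_wpM2l (addr_ge0 (sqr_ge0 sigma) (sqr_ge0 Cg)) (f_smooth i u v).
rewrite /M1 /M2; lra.
Qed.

Lemma G_mean i w v k :
  Ebatch B2 (fun xi => G i w v xi k 0) = ((Jfull Jg i w)^T *m gradf i v) k 0.
Proof.
rewrite -[LHS]/(avg _ _) mxE.
rewrite (@eq_avg _ _ _ _ (fun xi => \sum_l gradf i v l 0 * JB Jg B2 i xi w l k)); last first.
  by move=> xi _; rewrite mxE; apply: eq_bigr => l _; rewrite mxE mulrC.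
rewrite avg_sum; apply: eq_bigr => l _.
by rewrite avgZ mulrC mxE; congr (_ * _); exact: (@avg_batch_mean R n B2 B2_gt0 B2n).
Qed.

Lemma mean_cst (c : R) : m%:R^-1 * \sum_(i < m) c = c.
Proof. by rewrite sumr_const card_ord -[c *+ m]mulr_natl mulKf// gt_eqF// m_gt0. Qed.

(** Up to centred noise the new error is exactly [1 - alpha] times the old one. The noise combines
    an anchored difference with weight [alpha] and a one-step difference with weight [1 - alpha], so
    both are small when the iterates move little. *)
Lemma avg_Zerr wn wa wc (un ua uc : 'I_m -> 'cV[R]_p) z :
  Es (fun s : sample => sqn ((1 - alpha) *: z
     + alpha *: (B1%:R^-1 *: \sum_(i in s.1)
          (G i wn (un i) (s.2 i) - G i wa (ua i) (s.2 i)) + Gbar wa ua)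
     + ((1 - alpha) / B1%:R) *: \sum_(i in s.1)
          (G i wn (un i) (s.2 i) - G i wc (uc i) (s.2 i)) - Gbar wn un)) <=
  (1 - alpha) * sqn (z - Gbar wc uc)
  + 2 * alpha ^+ 2 * (M1 * sqn (wn - wa) + M2 * msq un ua)
  + 2 * (M1 * sqn (wn - wc) + M2 * msq un uc).
Proof.
pose Q i xi := alpha *: (G i wn (un i) xi - G i wa (ua i) xi)
  + (1 - alpha) *: (G i wn (un i) xi - G i wc (uc i) xi).
pose X (s : sample) := B1%:R^-1 *: \sum_(i in s.1) Q i (s.2 i).
pose mu := alpha *: (Gbar wn un - Gbar wa ua) + (1 - alpha) *: (Gbar wn un - Gbar wc uc).
pose c := (1 - alpha) *: (z - Gbar wc uc).
have [s0 s0B] := valid_sample_exists B1m B2n.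
rewrite (@eq_avg _ _ _ _ (fun s : sample => sqn (c + (X s - mu)))); last first.
  move=> s _; congr sqn; rewrite /c /mu.
  set S1 := \sum_(i in s.1) _; set S2 := \sum_(i in s.1) _.
  have -> : X s = B1%:R^-1 *: (alpha *: S1 + (1 - alpha) *: S2).
    by rewrite !scaler_sumr -big_split.
  by apply/colP => k; rewrite !mxE; ring.
have Xmu k : Es (fun s : sample => X s k 0) = mu k 0.
  rewrite (@eq_avg _ _ _ _ (fun s : sample =>
      B1%:R^-1 * \sum_(i in s.1) (Q i (s.2 i)) k 0)); last first.
    by move=> s _; rewrite /X mxE summxE.
  rewrite (@avg_block_mean R m n B1 B2 B1_gt0 B1m B2n (fun i xi => Q i xi k 0)).
  rewrite /mu /Gbar !mxE !summxE -!mulrBr mulrCA [(1 - alpha) * _]mulrCA -mulrDr.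
  congr (_ * _); rewrite -!sumrB !mulr_sumr -big_split; apply: eq_bigr => i _ /=.
  rewrite -!G_mean -![Ebatch _ _]/(avg _ _) -!avgB -!avgZ -avgD.
  by apply: eq_avg => xi _; rewrite !mxE.
apply: (le_trans (@avg_sqn_shift_le R _ _ _ X c mu s0 s0B Xmu)).
rewrite -addrA; apply: lerD.
  rewrite /c sqnZ ler_wpM2r ?sqn_ge0//; case/andP: alpha01 => *; nra.
apply: (le_trans (avg_block_mean_sqn_le B1_gt0 B1m B2n Q)).
have -> : 2 * alpha ^+ 2 * (M1 * sqn (wn - wa) + M2 * msq un ua) +
    2 * (M1 * sqn (wn - wc) + M2 * msq un uc) =
   m%:R^-1 * \sum_i (2 * alpha ^+ 2 * (M1 * sqn (wn - wa) + M2 * sqn (un i - ua i)) +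
    2 * (M1 * sqn (wn - wc) + M2 * sqn (un i - uc i))).
  rewrite -[in LHS](mean_cst (M1 * sqn (wn - wa))).
  rewrite -[in LHS](mean_cst (M1 * sqn (wn - wc))) /msq.
  by rewrite big_split/= -!mulr_sumr !big_split/= -!mulr_sumr; ring.
rewrite ler_wpM2l ?invr_ge0 ?ler0n//; apply: ler_sum => i _.
have pw xi : sqn (Q i xi) <= 2 * alpha ^+ 2 * sqn (G i wn (un i) xi - G i wa (ua i) xi)
    + 2 * sqn (G i wn (un i) xi - G i wc (uc i) xi).
  have := sqnD_le2 (alpha *: (G i wn (un i) xi - G i wa (ua i) xi))
    ((1 - alpha) *: (G i wn (un i) xi - G i wc (uc i) xi)).
  rewrite !sqnZ => /le_trans; apply; rewrite mulrA lerD2l ler_wpM2l ?ler0n//.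
  rewrite ler_piMl ?sqn_ge0//; case/andP: alpha01 => *; nra.
apply: (le_trans (Ebatch_le pw)); rewrite EbatchD !EbatchZ.
have a2 := sqr_ge0 alpha.
by apply: lerD; (apply: ler_wpM2l; [lra|exact: G_lip]).
Qed.

Lemma msq_ge0 u v : 0 <= msq u v.
Proof. by rewrite mulr_ge0 ?invr_ge0 ?ler0n ?sumr_ge0// => i _; exact: sqn_ge0. Qed.

Lemma avg_msq_le (P : sample -> 'I_m -> R) (A : 'I_m -> R) :
  (forall i, Es (fun s => P s i) <= A i) ->
  Es (fun s => m%:R^-1 * \sum_i P s i) <= m%:R^-1 * \sum_i A i.
Proof.
move=> PA; rewrite avgZ avg_sum ler_wpM2l ?invr_ge0 ?ler0n//.
by apply: ler_sum => i _; exact: PA.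
Qed.

Lemma Uerr_step t s :
  Es (fun x => Uerr (step t s x)) <= (1 - pa * beta) * Uerr s
  + 2 * pa * beta ^+ 2 * Cg ^+ 2 * sqn (w_next s - wanchor t s)
  + 13 / pa * Cg ^+ 2 * Winc s.
Proof.
apply: (le_trans (avg_msq_le (fun i => avg_Uerr_block
  (w_next s) (wanchor t s) (w_cur s) (u_cur s i) i))).
by rewrite !big_split/= !mulrDr !mean_cst -mulr_sumr [m%:R^-1 * (_ * _)]mulrCA.
Qed.

Lemma Vinc_step t s :
  Es (fun x => Vinc (step t s x)) <= 8 * pa * beta ^+ 2 * Uerr s
  + 8 * pa * beta ^+ 2 * Cg ^+ 2 * sqn (w_next s - wanchor t s)
  + 18 / pa * Cg ^+ 2 * Winc s.
Proof.
apply: (le_trans (avg_msq_le (fun i => avg_Vinc_block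
  (w_next s) (wanchor t s) (w_cur s) (u_cur s i) i))).
by rewrite !big_split/= !mulrDr !mean_cst -mulr_sumr [m%:R^-1 * (_ * _)]mulrCA.
Qed.

Lemma Zerr_step t s :
  Es (fun x => Zerr (step t s x)) <= (1 - alpha) * Zerr s
  + 2 * alpha ^+ 2 * (M1 * sqn (w_next s - wanchor t s)
                      + M2 * msq (u_cur s) (uanchor t s))
  + 2 * (M1 * Winc s + M2 * Vinc s).
Proof.
exact: (avg_Zerr (w_next s) (wanchor t s) (w_cur s) (u_cur s) (uanchor t s) (u_prev s)).
Qed.

Lemma Gbar_lip w u v :
  sqn (Gbar w u - Gbar w v) <= Cg ^+ 2 * Lf ^+ 2 * msq u v.
Proof.
rewrite /Gbar -scalerBr -sumrB.
apply: (le_trans (sqn_mean_le _ _ m_gt0)); first by rewrite card_ord.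
rewrite /msq mulrCA ler_wpM2l ?invr_ge0 ?ler0n// mulr_sumr; apply: ler_sum => i _.
rewrite -mulmxBr (le_trans (J_bound _ _ _))// -[X in _ <= X]mulrA.
by apply: ler_wpM2l; [exact: sqr_ge0|exact: f_smooth].
Qed.

(** Valid for every sample. The new z aims at gradients taken at [u_cur s], which tracks g at
    [w_cur s] rather than at [w_next s]; this lag costs the error of u at the old state and one
    displacement. *)
Lemma grad_error_step t s x :
  sqn (Gbar (w_next s) (fun i => g i (w_next s)) - z_cur (step t s x)) <=
  2 * Zerr (step t s x) + 4 * Cg ^+ 2 * Lf ^+ 2 * (Uerr s + Cg ^+ 2 * Winc s).
Proof.
set s' := step t s x; pose wn := w_next s.
have -> : Gbar wn (fun i => g i wn) - z_cur s' =
  (Gbar wn (fun i => g i wn) - Gbar wn (u_cur s)) - (z_cur s' - Gbar wn (u_cur s)).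
  by rewrite opprB addrA subrK.
have h := sqnB_le2 (Gbar wn (fun i => g i wn) - Gbar wn (u_cur s))
  (z_cur s' - Gbar wn (u_cur s)).
have h1 := Gbar_lip wn (fun i => g i wn) (u_cur s).
have h2 : msq (fun i => g i wn) (u_cur s) <= 2 * Uerr s + 2 * (Cg ^+ 2 * Winc s).
  have -> : 2 * Uerr s + 2 * (Cg ^+ 2 * Winc s) =
      m%:R^-1 * \sum_i (2 * sqn (u_cur s i - g i (w_cur s)) + 2 * (Cg ^+ 2 * Winc s)).
    by rewrite big_split/= mulrDr mean_cst -mulr_sumr mulrCA.
  rewrite /msq ler_wpM2l ?invr_ge0 ?ler0n//; apply: ler_sum => i _.
  have -> : g i wn - u_cur s i = (g i wn - g i (w_cur s)) - (u_cur s i - g i (w_cur s)).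
    by rewrite opprB addrA subrK.
  have := sqnB_le2 (g i wn - g i (w_cur s)) (u_cur s i - g i (w_cur s)).
  have := g_lip i wn (w_cur s); rewrite /Winc -/wn; lra.
have h3 := ler_wpM2l (mulr_ge0 (sqr_ge0 Cg) (sqr_ge0 Lf)) h2.
have hz : Zerr s' = sqn (z_cur s' - Gbar wn (u_cur s)) by [].
apply: (le_trans h); rewrite -hz; move: (le_trans h1 h3).
move: (sqn _) (Zerr s') (Uerr s) (Winc s) => X Z U W; lra.
Qed.

End OneStep.

(** * Whole runs *)

(** One factor [I] is the Cauchy-Schwarz cost of a sum of at most [I] increments, the other counts
    the later times of the epoch at which an increment is felt. Index [t] stands for iteration t +
    1, hence the test on [t.+2]. *)
Lemma anchored_sum_le {R : realType} k (I N : nat) (x y : nat -> 'cV[R]_k) :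
  (0 < I)%N -> x 0%N = y 0%N ->
  (forall t, y t.+1 = if (t.+2 %% I == 0)%N then x t.+1 else y t) ->
  \sum_(t < N.+1) sqn (x t - y t) <= I%:R ^+ 2 * \sum_(t < N) sqn (x t.+1 - x t).
Proof.
move=> I0 xy0 yS; pose c t := sqn (x t.+1 - x t).
have c0 t : 0 <= c t by exact: sqn_ge0.
(* Squared increments accumulated since the latest anchor. *)
pose Q := fix Q t : R :=
  if t is t'.+1 then if (t'.+2 %% I == 0)%N then 0 else Q t' + c t' else 0.
have Q0 t : 0 <= Q t by elim: t => //= t IH; case: ifP => // _; exact: addr_ge0.
(* [t.+1 %% I] is the age of the anchor, overestimated by at most one in the first epoch, whose
   anchor is iteration 1. *)
have xyQ t : sqn (x t - y t) <= (t.+1 %% I)%:R * Q t.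
  elim: t => [|t IH]; first by rewrite xy0 subrr sqn0 mulr0.
  rewrite yS /=; case: ifPn => [_|tI]; first by rewrite subrr sqn0 mulr0.
  have -> : (t.+2 %% I)%N = (t.+1 %% I).+1 by rewrite modnS /dvdn (negbTE tI).
  rewrite (_ : _ - _ = (x t - y t) + (x t.+1 - x t)); last by rewrite [RHS]addrC addrA subrK.
  exact: sqnD_le_nat.
have tI t : (t.+1 %% I)%:R + 1 <= I%:R :> R by rewrite natr1 ler_nat ltn_pmod.
(* The potential [(I - q) Q], with [q] the age of the anchor, absorbs the resets. *)
have sumQ t : \sum_(j < t) Q j + (I%:R - (t.+1 %% I)%:R) * Q t <=
    I%:R * \sum_(j < t) c j.
  elim: t => [|t IH]; first by rewrite !big_ord0 mulr0 addr0 mulr0.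
  rewrite !big_ord_recr/= mulrDr.
  have IQ : Q t <= (I%:R - (t.+1 %% I)%:R) * Q t by rewrite ler_peMl//; have := tI t; lra.
  case: ifPn => [_|tI0].
    have : 0 <= I%:R * c t by rewrite mulr_ge0.
    lra.
  have -> : (t.+2 %% I)%:R = (t.+1 %% I)%:R + 1 :> R.
    by rewrite modnS /dvdn (negbTE tI0) natr1.
  have : (t.+1 %% I)%:R * c t >= 0 by rewrite mulr_ge0 ?ler0n.
  have := c0 t; lra.
have I0R : 0 <= I%:R :> R by rewrite ler0n.
have leIQ t : sqn (x t - y t) <= I%:R * Q t.
  by rewrite (le_trans (xyQ t))// ler_wpM2r//; have := tI t; lra.
apply: (@le_trans _ _ (I%:R * \sum_(t < N.+1) Q t)).
  by rewrite mulr_sumr; apply: ler_sum => t _.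
rewrite expr2 -mulrA ler_wpM2l// big_ord_recr/=.
apply: le_trans (sumQ N); rewrite lerD2l ler_peMl//; have := tI N; lra.
Qed.

Section Runs.
Context {R : realType}.
Variables (d p m n : nat).
Variable gs : 'I_m -> 'I_n -> 'cV[R]_d -> 'cV[R]_p.
Variable Jg : 'I_m -> 'I_n -> 'cV[R]_d -> 'M[R]_(p, d).
Variable gradf : 'I_m -> 'cV[R]_p -> 'cV[R]_p.
Variables (B1 B2 I : nat) (alpha beta eta : R).
Variables (w1 : 'cV[R]_d) (u1 : 'I_m -> 'cV[R]_p) (z1 : 'cV[R]_d).
Hypotheses (B1m : (B1 <= m)%N) (B2n : (B2 <= n)%N).

Local Notation step := (step gs Jg gradf B1 B2 I alpha beta eta).
Local Notation run := (run gs Jg gradf B1 B2 I alpha beta eta w1 u1 z1).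
Local Notation state := (state R d p m).
Local Notation sample := (sample m n).

Lemma run_ext (o o' : nat -> sample) t :
  (forall j, (j <= t)%N -> o j = o' j) -> run o t = run o' t.
Proof.
elim: t => [//|[//|t] IH] oo'.
rewrite -[LHS]/(step t.+2 (run o t.+1) (o t.+2)).
rewrite -[RHS]/(step t.+2 (run o' t.+1) (o' t.+2)).
by rewrite IH ?oo'// => j jt; rewrite oo'// leqW.
Qed.

Variable N : nat.
Local Notation path := (Defs.path m n N.+1).

(** Every expectation lives on the same space of paths of T = N + 1 iterations. Index [k] means
    iteration k + 1, so index 0 is the deterministic initial state. *)
Definition expect_at (k : nat) (f : state -> R) : R :=
  Epath B1 B2 (fun om : path => f (run (path_fun om) k.+1)).

Lemma valid_path_exists : exists om : path, valid_path B1 B2 om.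
Proof.
have [s sB] := valid_sample_exists B1m B2n.
by exists [ffun=> s]; apply/forallP => k; rewrite ffunE.
Qed.

Lemma expect_at_cst k c : expect_at k (fun=> c) = c.
Proof.
have [om omB] := valid_path_exists.
exact: (@avg_cst R _ (fun om : path => valid_path B1 B2 om) _ om).
Qed.

Lemma expect_atD k f g : expect_at k (fun s => f s + g s) = expect_at k f + expect_at k g.
Proof. exact: avgD. Qed.

Lemma expect_atZ k c f : expect_at k (fun s => c * f s) = c * expect_at k f.
Proof. exact: avgZ. Qed.

Lemma expect_at_ge0 k f : (forall s, 0 <= f s) -> 0 <= expect_at k f.
Proof. by move=> f0; apply: avg_ge0. Qed.

(** Tower property: the state of iteration k + 1 reads samples of index at most k + 1, so the sample
    of index k + 2 can be averaged out first. *)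
Lemma expect_at_step k (h : state -> sample -> R) : (k < N)%N ->
  Epath B1 B2 (fun om : path => h (run (path_fun om) k.+1) (path_fun om k.+2)) =
  expect_at k (fun s => avg (@valid_sample m n B1 B2) (h s)).
Proof.
move=> kN; have [s0 s0B] := valid_sample_exists B1m B2n.
have kN2 : (k.+2 < N.+2)%N by [].
pose K := Ordinal kN2.
have pK (om : path) : path_fun om k.+2 = om K by rewrite /path_fun insubT.
rewrite -[LHS]/(avg _ _); under eq_avg do rewrite pK.
apply: (@avg_ffun_fubini R _ _ (@valid_sample m n B1 B2) K
  (fun (om : path) x => h (run (path_fun om) k.+1) x) s0) => // om s x.
congr h; apply: run_ext => j jk; rewrite /path_fun.
case: insubP => //= i _ ij; rewrite ffunE.
by case: eqP => // iK; move: jk; rewrite -ij iK/= ltnn.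
Qed.

Lemma expect_atS_le k (f : state -> R) (b : state -> R) : (k < N)%N ->
  (forall s, avg (@valid_sample m n B1 B2) (fun x => f (step k.+2 s x)) <= b s) ->
  expect_at k.+1 f <= expect_at k b.
Proof.
move=> kN fb; rewrite /expect_at.
rewrite [X in X <= _](expect_at_step (fun s x => f (step k.+2 s x)) kN).
by apply: ler_avg => om _; exact: fb.
Qed.

(** The comparison is asked on reachable states only, because invariants such as [w_next_run] fail
    for an arbitrary record. *)
Lemma expect_at_le k (f g : state -> R) :
  (forall om, f (run om k.+1) <= g (run om k.+1)) -> expect_at k f <= expect_at k g.
Proof. by move=> fg; apply: ler_avg => om _; exact: fg. Qed.

Lemma w_next_run om k :
  w_next (run om k.+1) = w_cur (run om k.+1) - eta *: z_cur (run om k.+1).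
Proof. by case: k. Qed.

Hypothesis I_gt0 : (0 < I)%N.

Lemma sum_Wanc_le :
  \sum_(k < N.+1) expect_at k (@Wanc R d p m) <=
  I%:R ^+ 2 * \sum_(k < N) expect_at k (@Winc R d p m).
Proof.
suff h (om : path) : \sum_(k < N.+1) Wanc (run (path_fun om) k.+1) <=
    I%:R ^+ 2 * \sum_(k < N) Winc (run (path_fun om) k.+1).
  have := @ler_avg R path (@valid_path m n B1 B2 N.+1) _ _ (fun om _ => h om).
  by rewrite avgZ !avg_sum.
apply: (@anchored_sum_le R d I N (fun k => w_cur (run (path_fun om) k.+1))
  (fun k => w_tau (run (path_fun om) k.+1)) I_gt0) => //.
Qed.

Lemma sum_Yanc_le :
  \sum_(k < N.+1) expect_at k (@Yanc R d p m) <=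
  I%:R ^+ 2 * \sum_(k < N) expect_at k (@Vinc R d p m).
Proof.
suff h (om : path) : \sum_(k < N.+1) Yanc (run (path_fun om) k.+1) <=
    I%:R ^+ 2 * \sum_(k < N) Vinc (run (path_fun om) k.+1).
  have := @ler_avg R path (@valid_path m n B1 B2 N.+1) _ _ (fun om _ => h om).
  by rewrite avgZ !avg_sum.
rewrite /Yanc /Vinc /msq -!mulr_sumr mulrCA ler_wpM2l ?invr_ge0 ?ler0n//.
rewrite exchange_big [X in _ <= _ * X]exchange_big/= mulr_sumr.
apply: ler_sum => i _.
apply: (@anchored_sum_le R p I N (fun k => u_prev (run (path_fun om) k.+1) i)
  (fun k => u_tau (run (path_fun om) k.+1) i) I_gt0) => // t.
by rewrite /=; case: ifP.
Qed.

End Runs.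

(** * Summing the coupled error recursions *)

Section Sequences.
Context {R : realType}.

(** Telescoping of [rho * x k <= x k - x k.+1 + y k]; the leftover [x N] pays for the last term
    since [rho <= 1]. *)
Lemma contraction_sum_le (N : nat) (rho : R) (x y : nat -> R) :
  0 <= rho <= 1 -> x 0%N = 0 -> (forall k, 0 <= x k) ->
  (forall k, (k < N)%N -> x k.+1 <= (1 - rho) * x k + y k) ->
  rho * \sum_(k < N.+1) x k <= \sum_(k < N) y k.
Proof.
move=> /andP[r0 r1] x0 xge0 xS.
have : rho * \sum_(k < N) x k + x N <= \sum_(k < N) y k.
  elim: N xS => [_|N IH xS]; first by rewrite !big_ord0 x0 mulr0 addr0.
  rewrite !big_ord_recr/= mulrDr.
  have := xS N (ltnSn N); have := IH (fun k kN => xS k (leqW kN)); lra.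
rewrite big_ord_recr/= mulrDr; have := ler_piMl (xge0 N) r1; lra.
Qed.

Lemma sum_shift_le (N : nat) (x : nat -> R) : 0 <= x 0%N ->
  \sum_(k < N) x k.+1 <= \sum_(k < N.+1) x k.
Proof. by move=> x0; rewrite big_ord_recl/= lerDr. Qed.

Lemma sum_widen_le (N : nat) (x : nat -> R) : (forall k, 0 <= x k) ->
  \sum_(k < N) x k <= \sum_(k < N.+1) x k.
Proof. by move=> x0; rewrite big_ord_recr/= lerDl. Qed.

Lemma gradient_error_sum (N : nat) (a b Cg2 Lf2 M1 M2 J : R) (U V W Y Z D E : nat -> R) :
  0 < a <= 1 -> 0 < b <= 1 -> 0 <= Cg2 -> 0 <= Lf2 -> 0 <= M1 -> 0 <= M2 ->
  J = 1 / (a * b) ->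
  (forall k, 0 <= U k) -> (forall k, 0 <= V k) -> (forall k, 0 <= W k) ->
  (forall k, 0 <= Y k) -> (forall k, 0 <= Z k) -> (forall k, 0 <= D k) ->
  U 0%N = 0 -> V 0%N = 0 -> Z 0%N = 0 -> E 0%N = 0 ->
  (forall k, (k < N)%N -> U k.+1 <= (1 - a * (b / 2)) * U k
     + 2 * a * (b / 2) ^+ 2 * Cg2 * W k.+1 + 13 / a * Cg2 * D k) ->
  (forall k, (k < N)%N -> V k.+1 <= 8 * a * (b / 2) ^+ 2 * U k
     + 8 * a * (b / 2) ^+ 2 * Cg2 * W k.+1 + 18 / a * Cg2 * D k) ->
  (forall k, (k < N)%N -> Z k.+1 <= (1 - a * b) * Z k
     + 2 * (a * b) ^+ 2 * (M1 * W k.+1 + M2 * Y k.+1) + 2 * (M1 * D k + M2 * V k)) ->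
  (forall k, (k < N)%N -> E k.+1 <= 2 * Z k.+1 + 4 * Cg2 * Lf2 * (U k + Cg2 * D k)) ->
  \sum_(k < N.+1) W k <= J ^+ 2 * \sum_(k < N) D k ->
  \sum_(k < N.+1) Y k <= J ^+ 2 * \sum_(k < N) V k ->
  \sum_(k < N.+1) E k <= (8 * M1 + 592 * M2 * Cg2 + 112 * Cg2 ^+ 2 * Lf2)
     * ((\sum_(k < N.+1) D k) / (a ^+ 2 * b)).
Proof.
move=> /andP[a0 a1] /andP[b0 b1] C0 L0 M10 M20 JE U0 V0 W0 Y0 Z0 D0.
move=> U00 V00 Z00 E00 US VS ZS ES sW sY.
set SW := \sum_(k < N.+1) W k in sW; set SY := \sum_(k < N.+1) Y k in sY.
set SD := \sum_(k < N.+1) D k; set SZ := \sum_(k < N.+1) Z k.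
set SU := \sum_(k < N.+1) U k; set SV := \sum_(k < N.+1) V k.
have ab0 : 0 < a * b by rewrite mulr_gt0.
have J0 : 0 < J by rewrite JE divr_gt0.
have J2 : 0 <= J ^+ 2 by exact: sqr_ge0.
have SD0 : 0 <= SD by apply: sumr_ge0 => k _.
have SU0 : 0 <= SU by apply: sumr_ge0 => k _.
have leD : \sum_(k < N) D k <= SD by exact: sum_widen_le.
have leU : \sum_(k < N) U k <= SU by exact: sum_widen_le.
have leV : \sum_(k < N) V k <= SV by exact: sum_widen_le.
have leW1 : \sum_(k < N) W k.+1 <= SW by exact: sum_shift_le.
have leY1 : \sum_(k < N) Y k.+1 <= SY by exact: sum_shift_le.
have leZ1 : \sum_(k < N) Z k.+1 <= SZ by exact: sum_shift_le.
have SWle : SW <= J ^+ 2 * SD by rewrite (le_trans sW)// ler_wpM2l.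
have SYle : SY <= J ^+ 2 * SV by rewrite (le_trans sY)// ler_wpM2l.
have ia : 0 < a^-1 by rewrite invr_gt0.
have hU : a * (b / 2) * SU <= 2 * a * (b / 2) ^+ 2 * Cg2 * SW + 13 / a * Cg2 * SD.
  have rho : 0 <= a * (b / 2) <= 1 by apply/andP; split; nra.
  apply: (le_trans (@contraction_sum_le N _ U (fun k => 2 * a * (b / 2) ^+ 2 * Cg2 * W k.+1
      + 13 / a * Cg2 * D k) rho U00 U0 _)).
    by move=> k kN; rewrite addrA; exact: US.
  rewrite big_split/= -!mulr_sumr; apply: lerD; apply: ler_wpM2l => //.
    by rewrite mulr_ge0// mulr_ge0 ?sqr_ge0// mulr_ge0// ltW.
  by rewrite mulr_ge0// mulr_ge0// ltW.
have hV : SV <= 8 * a * (b / 2) ^+ 2 * SU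
     + 8 * a * (b / 2) ^+ 2 * Cg2 * SW + 18 / a * Cg2 * SD.
  rewrite /SV big_ord_recl V00 add0r.
  apply: (@le_trans _ _ (\sum_(k < N) (8 * a * (b / 2) ^+ 2 * U k
     + 8 * a * (b / 2) ^+ 2 * Cg2 * W k.+1 + 18 / a * Cg2 * D k))).
    by apply: ler_sum => k _; exact: VS.
  have ab : 0 <= 8 * a * (b / 2) ^+ 2.
    by apply: mulr_ge0; [apply: mulr_ge0; [|exact: ltW]|exact: sqr_ge0].
  rewrite !big_split/= -!mulr_sumr; apply: lerD; first apply: lerD; apply: ler_wpM2l => //.
    by rewrite mulr_ge0.
  by rewrite mulr_ge0// mulr_ge0// ltW.
have hZ : a * b * SZ <= 2 * (a * b) ^+ 2 * (M1 * SW + M2 * SY)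
    + 2 * (M1 * SD + M2 * SV).
  have rho : 0 <= a * b <= 1 by apply/andP; split; nra.
  apply: (le_trans (@contraction_sum_le N _ Z (fun k =>
      2 * (a * b) ^+ 2 * (M1 * W k.+1 + M2 * Y k.+1) + 2 * (M1 * D k + M2 * V k))
      rho Z00 Z0 _)).
    by move=> k kN; rewrite addrA; exact: ZS.
  rewrite big_split/= -!mulr_sumr !big_split/= -!mulr_sumr.
  have ab2 := sqr_ge0 (a * b).
  apply: lerD; (apply: ler_wpM2l; [lra|]); apply: lerD; exact: ler_wpM2l.
have hE : \sum_(k < N.+1) E k <= 2 * SZ + 4 * Cg2 * Lf2 * (SU + Cg2 * SD).
  rewrite big_ord_recl E00 add0r.
  apply: (@le_trans _ _ (\sum_(k < N) (2 * Z k.+1 + 4 * Cg2 * Lf2 * (U k + Cg2 * D k)))).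
    by apply: ler_sum => k _; exact: ES.
  rewrite big_split/= -!mulr_sumr big_split/= -mulr_sumr.
  apply: lerD; first exact: ler_wpM2l.
  apply: ler_wpM2l; first by rewrite mulr_ge0// mulr_ge0.
  by apply: lerD => //; exact: ler_wpM2l.
clearbody SD SU SV SW SY SZ.
(* The common unit: the totals of U and Z are of order [q], that of V of order [a * b * q], that of
   W at most [q / b]. *)
pose q := SD / (a ^+ 2 * b).
have an0 : a != 0 by rewrite gt_eqF.
have bn0 : b != 0 by rewrite gt_eqF.
have q0 : 0 <= q by apply: divr_ge0 => //; apply: mulr_ge0; [exact: sqr_ge0|exact: ltW].
have SDE : SD = a ^+ 2 * b * q by rewrite /q [RHS]mulrC divfK// mulf_neq0 ?expf_neq0.
have Cq0 : 0 <= Cg2 * q by rewrite mulr_ge0.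
have SWle' : SW <= q / b.
  apply: (le_trans SWle); rewrite JE /q le_eqVlt; apply/orP; left.
  by apply/eqP; field; rewrite an0 bn0.
(* 27 = 2 (1/2 + 13): the drift and displacement terms, divided by the rate ab/2. *)
have SUle : SU <= 27 * (Cg2 * q).
  rewrite -(ler_pM2l ab0).
  have h := ler_wpM2l (mulr_ge0 (mulr_ge0 (ltW a0) (sqr_ge0 b)) C0) SWle'.
  have e1 : a * b ^+ 2 * Cg2 * (q / b) = a * b * (Cg2 * q) by field.
  have e2 : 13 / a * Cg2 * SD = 13 * (a * b * (Cg2 * q)) by rewrite SDE; field.
  rewrite e1 in h; rewrite e2 in hU; nra.
(* 74 = 2 * 27 + 2 + 18, from U, W and D in turn. *)
have SVle : SV <= 74 * (a * b * (Cg2 * q)).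
  have h := ler_wpM2l (mulr_ge0 (mulr_ge0 (ltW a0) (sqr_ge0 b)) C0) SWle'.
  have e1 : a * b ^+ 2 * Cg2 * (q / b) = a * b * (Cg2 * q) by field.
  have e2 : 18 / a * Cg2 * SD = 18 * (a * b * (Cg2 * q)) by rewrite SDE; field.
  have h2 := ler_wpM2l (mulr_ge0 (ltW a0) (sqr_ge0 b)) SUle.
  have h3 : a * b ^+ 2 * (27 * (Cg2 * q)) <= 27 * (a * b * (Cg2 * q)).
    rewrite -subr_ge0 (_ : _ - _ = 27 * (a * b * (Cg2 * q)) * (1 - b)); last by ring.
    by rewrite mulr_ge0 ?subr_ge0// mulr_ge0// mulr_ge0// ltW.
  rewrite e1 in h; rewrite e2 in hV.
  have e3 : 8 * a * (b / 2) ^+ 2 = 2 * (a * b ^+ 2) by field.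
  rewrite e3 in hV; lra.
have a2a : a ^+ 2 <= a by rewrite expr2 ler_piMl// ltW.
(* Here [alpha ^+ 2] cancels the epoch factor exactly, as [J = 1 / (a * b)]. *)
have SYle' : (a * b) ^+ 2 * SY <= SV.
  have := ler_wpM2l (sqr_ge0 (a * b)) SYle.
  by rewrite mulrA -exprMn JE mulrA mulr1 divff ?mulf_neq0// expr1n mul1r.
have SWle'' : (a * b) ^+ 2 * SW <= a * b * q.
  have := ler_wpM2l (sqr_ge0 (a * b)) SWle.
  rewrite mulrA -exprMn JE mulrA mulr1 divff ?mulf_neq0// expr1n mul1r SDE => /le_trans; apply.
  by rewrite ler_wpM2r// ler_wpM2r// ltW.
have SDle : SD <= a * b * q by rewrite SDE ler_wpM2r// ler_wpM2r// ltW.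
have SDle' : SD <= q by rewrite (le_trans SDle)// ler_piMl//; nra.
have SZle : SZ <= 4 * M1 * q + 296 * M2 * (Cg2 * q).
  rewrite -(ler_pM2l ab0).
  have m1 := ler_wpM2l M10 SWle''; have m2 := ler_wpM2l M10 SDle.
  have m3 := ler_wpM2l M20 SYle'; have m4 := ler_wpM2l M20 SVle.
  lra.
apply: (le_trans hE); rewrite -/q.
have h1 : SU + Cg2 * SD <= 28 * (Cg2 * q).
  have := ler_wpM2l C0 SDle'; lra.
have := ler_wpM2l (mulr_ge0 C0 L0) h1; lra.
Qed.

End Sequences.

(** * Gradient of the objective and convergence *)

Section ChainRule.
Context {R : realType}.
Import numFieldNormedType.Exports.

Lemma diff_mean (V W : normedModType R) k (c : R) (f : 'I_k -> V -> W) x h :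
  (forall j, differentiable (f j) x) ->
  differentiable (fun w => c *: \sum_(j < k) f j w) x /\
  'd (fun w => c *: \sum_(j < k) f j w) x h = c *: \sum_(j < k) 'd (f j) x h.
Proof.
move=> fx.
have E : (fun w => c *: \sum_(j < k) f j w) = c *: (\sum_(j < k) f j).
  by apply/funext => w; rewrite [RHS]/(_ *: _) fct_sumE.
have dF : differentiable (fun w => c *: \sum_(j < k) f j w) x.
  by rewrite E; apply: differentiableZ; exact: differentiable_sum.
split=> //; rewrite -deriveE// E deriveZ; last first.
  by apply: derivable_sum => j; exact: diff_derivable.
rewrite derive_sum; last by move=> j; exact: diff_derivable.
by congr (_ *: _); apply: eq_bigr => j _; rewrite deriveE.
Qed.

Variables (d p m n : nat).
Variables (f : 'I_m -> 'cV[R]_p -> R) (gradf : 'I_m -> 'cV[R]_p -> 'cV[R]_p).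
Variable gs : 'I_m -> 'I_n -> 'cV[R]_d -> 'cV[R]_p.
Variable Jg : 'I_m -> 'I_n -> 'cV[R]_d -> 'M[R]_(p, d).
Hypothesis gs_diff : forall i j w, differentiable (gs i j) w /\
  forall h, 'd (gs i j) w h = Jg i j w *m h.

Lemma diff_gfull i w : differentiable (gfull gs i) w /\
  forall h, 'd (gfull gs i) w h = Jfull Jg i w *m h.
Proof.
have gd := fun h => @diff_mean _ _ n n%:R^-1 (gs i) w h (fun j => (gs_diff i j w).1).
split=> [|h]; first exact: (gd 0).1.
rewrite (gd h).2 /Jfull -scalemxAl mulmx_suml; congr (_ *: _).
by apply: eq_bigr => j _; rewrite (gs_diff i j w).2.
Qed.

Hypothesis f_diff : forall i u, differentiable (f i : _ -> R^o) u /\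
  forall h, 'd (f i : _ -> R^o) u h = dotv (gradf i u) h.

(** A gradient is determined by its pairing with all directions; the chain rule then moves the
    Jacobian, transposed, across the dot product. *)
Lemma gradF_eq gradF :
  (forall w, differentiable (Fobj f gs : _ -> R^o) w /\
     forall h, 'd (Fobj f gs : _ -> R^o) w h = dotv (gradF w) h) ->
  forall w, gradF w = Gbar Jg gradf w (fun i => gfull gs i w).
Proof.
move=> Fd w; apply: dotv_eq => h; rewrite -(Fd w).2.
have fgd i : differentiable (fun w => f i (gfull gs i w) : R^o) w.
  apply: (@differentiable_comp R _ _ R^o (gfull gs i) (f i)).
    exact: (diff_gfull i w).1.
  exact: (f_diff i _).1.
rewrite -[Fobj f gs]/(fun w => m%:R^-1 *: (\sum_(i < m) (f i (gfull gs i w) : R^o))).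
rewrite (@diff_mean _ R^o m m%:R^-1 (fun i w => f i (gfull gs i w)) w h fgd).2.
rewrite /Gbar dotvC dotvZr -[_ *: _]/(_ * _); congr (_ * _).
apply: (@eq_trans _ _ (\sum_(i < m) dotv h ((Jfull Jg i w)^T *m gradf i (gfull gs i w)))).
  apply: eq_bigr => i _.
  rewrite (@diff_comp R _ _ R^o (gfull gs i) (f i)); first last.
  - exact: (f_diff i _).1.
  - exact: (diff_gfull i w).1.
  by rewrite /= (f_diff i _).2 (diff_gfull i w).2 dotvC dotvC [RHS]dotvC dotv_trmx.
elim/big_ind2: _ => //; last by move=> a1 a2 b1 b2 -> ->; rewrite dotvDr.
by apply/esym/big1 => i _; rewrite [X in _ * X]mxE mulr0.
Qed.

End ChainRule.

(** The factor 2 makes room for squared norms: [sqnD_le2] gives 2(A^2 + B^2), which is at most (2(A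
    + B))^2. *)
Lemma Gbar_diag_lip {R : realType} (d p m n : nat)
    (gs : 'I_m -> 'I_n -> 'cV[R]_d -> 'cV[R]_p)
    (Jg : 'I_m -> 'I_n -> 'cV[R]_d -> 'M[R]_(p, d))
    (gradf : 'I_m -> 'cV[R]_p -> 'cV[R]_p) (Lf Cf Lg Cg : R) : (0 < m)%N ->
  0 <= Lf -> 0 <= Cf -> 0 <= Lg -> 0 <= Cg ->
  (forall i u, sqn (gradf i u) <= Cf ^+ 2) ->
  (forall i u v, sqn (gradf i u - gradf i v) <= Lf ^+ 2 * sqn (u - v)) ->
  (forall i x y, sqn (gfull gs i x - gfull gs i y) <= Cg ^+ 2 * sqn (x - y)) ->
  (forall i x y, sqf (Jfull Jg i x - Jfull Jg i y) <= Lg ^+ 2 * sqn (x - y)) ->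
  (forall i x v, sqn ((Jfull Jg i x)^T *m v) <= Cg ^+ 2 * sqn v) ->
  forall x y, enorm (Gbar Jg gradf x (fun i => gfull gs i x)
                     - Gbar Jg gradf y (fun i => gfull gs i y)) <=
    2 * (Lg * Cf + Cg ^+ 2 * Lf) * enorm (x - y).
Proof.
move=> m0 Lf0 Cf0 Lg0 Cg0 hf hLf hg hJ hJb x y.
have C2 := sqr_ge0 Cg.
have K0 : 0 <= 2 * (Lg * Cf + Cg ^+ 2 * Lf).
  by apply: mulr_ge0 => //; apply: addr_ge0; exact: mulr_ge0.
rewrite sqr_enorm_le; last exact: mulr_ge0 K0 (enorm_ge0 _).
rewrite exprMn sqr_enorm /Gbar -scalerBr -sumrB.
apply: (le_trans (sqn_mean_le _ _ _)); rewrite ?card_ord// ?ltr0n//.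
set K := (2 * _) ^+ 2 * _.
have -> : K = m%:R^-1 * \sum_(i < m) K.
  by rewrite sumr_const card_ord -[K *+ m]mulr_natl mulKf// pnatr_eq0 -lt0n.
rewrite {}/K ler_wpM2l ?invr_ge0 ?ler0n//; apply: ler_sum => i _.
set gx := gradf i _; set gy := gradf i _.
have -> : (Jfull Jg i x)^T *m gx - (Jfull Jg i y)^T *m gy =
    (Jfull Jg i x - Jfull Jg i y)^T *m gx + (Jfull Jg i y)^T *m (gx - gy).
  by rewrite raddfB/= mulmxBl mulmxBr addrA subrK.
have h1 := sqnD_le2 ((Jfull Jg i x - Jfull Jg i y)^T *m gx) ((Jfull Jg i y)^T *m (gx - gy)).
have h2 : sqn ((Jfull Jg i x - Jfull Jg i y)^T *m gx) <= Lg ^+ 2 * sqn (x - y) * Cf ^+ 2.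
  apply: (le_trans (sqn_mulmx_tr _ _)).
  by apply: ler_pM; [exact: sqf_ge0|exact: sqn_ge0|exact: hJ|exact: hf].
have h3 : sqn ((Jfull Jg i y)^T *m (gx - gy)) <= Cg ^+ 2 * (Lf ^+ 2 * (Cg ^+ 2 * sqn (x - y))).
  apply: (le_trans (hJb _ _ _)); apply: ler_wpM2l => //.
  apply: (le_trans (hLf _ _ _)); apply: ler_wpM2l; [exact: sqr_ge0|exact: hg].
have h4 : 0 <= (Lg * Cf) * (Cg ^+ 2 * Lf) * sqn (x - y).
  by apply: mulr_ge0; [apply: mulr_ge0; exact: mulr_ge0|exact: sqn_ge0].
have k0 := mulr_ge0 (sqr_ge0 (Lg * Cf)) (sqn_ge0 (x - y)).
have k1 := mulr_ge0 (sqr_ge0 (Cg ^+ 2 * Lf)) (sqn_ge0 (x - y)).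
apply: (le_trans h1).
lra.
Qed.

Section Convergence.
Context {R : realType}.
Variables (d p m n : nat).
Variable gs : 'I_m -> 'I_n -> 'cV[R]_d -> 'cV[R]_p.
Variable Jg : 'I_m -> 'I_n -> 'cV[R]_d -> 'M[R]_(p, d).
Variable gradf : 'I_m -> 'cV[R]_p -> 'cV[R]_p.
Variables (B1 B2 I : nat) (eta : R).
Variables (w1 : 'cV[R]_d) (u1 : 'I_m -> 'cV[R]_p) (z1 : 'cV[R]_d).
Hypotheses (B1_gt0 : (0 < B1)%N) (B1m : (B1 <= m)%N).
Hypotheses (B2_gt0 : (0 < B2)%N) (B2n : (B2 <= n)%N).
Variables Lf Cf Lg Cg sigma L Delta : R.
Hypothesis f_lip : forall i u, sqn (gradf i u) <= Cf ^+ 2.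
Hypothesis f_smooth : forall i u v,
  sqn (gradf i u - gradf i v) <= Lf ^+ 2 * sqn (u - v).
Hypothesis g_lip : forall i x y,
  sqn (gfull gs i x - gfull gs i y) <= Cg ^+ 2 * sqn (x - y).
Hypothesis J_bound : forall i x v, sqn ((Jfull Jg i x)^T *m v) <= Cg ^+ 2 * sqn v.
Hypothesis J_var : forall i x,
  Ebatch B2 (fun xi => sqf (JB Jg B2 i xi x - Jfull Jg i x)) <= sigma ^+ 2.
Hypothesis gB_lip : forall i x y,
  Ebatch B2 (fun xi => sqn (gB gs B2 i xi x - gB gs B2 i xi y)) <=
  Cg ^+ 2 * sqn (x - y).
Hypothesis JB_lip : forall i x y,
  Ebatch B2 (fun xi => sqf (JB Jg B2 i xi x - JB Jg B2 i xi y)) <=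
  Lg ^+ 2 * sqn (x - y).
Variables (F : 'cV[R]_d -> R) (gradF : 'cV[R]_d -> 'cV[R]_d).
Hypothesis gradFE : forall w, gradF w = Gbar Jg gradf w (fun i => gfull gs i w).
Hypothesis F_descent : forall x h, F (x + h) <= F x + dotv (gradF x) h + L * sqn h.
Hypothesis F_bounded : forall w, F w1 - F w <= Delta.
Hypotheses (u1E : forall i, u1 i = gfull gs i w1) (z1E : z1 = gradF w1).

Local Notation a := (B1%:R / m%:R : R).
Local Notation b := (B2%:R / n%:R : R).
Local Notation E := (expect_at gs Jg gradf B1 B2 I (a * b) (b / 2) eta w1 u1 z1).
Hypothesis I_E : I%:R = 1 / (a * b).

Definition Cstar : R :=
  8 * M1 Cf Lg + 592 * M2 Lf Cg sigma * Cg ^+ 2 + 112 * (Cg ^+ 2) ^+ 2 * Lf ^+ 2.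

Lemma a_bounds : 0 < a <= 1.
Proof. by rewrite (pa_gt0 B1_gt0 B1m) (pa_le1 B1_gt0 B1m). Qed.

Lemma b_bounds : 0 < b <= 1.
Proof. by rewrite (pa_gt0 B2_gt0 B2n) (pa_le1 B2_gt0 B2n). Qed.

Lemma E0_init N f : E N 0 f = f (init eta w1 u1 z1).
Proof.
exact: (expect_at_cst gs Jg gradf I (a * b) (b / 2) eta w1 u1 z1 B1m B2n N 0
  (f (init eta w1 u1 z1))).
Qed.

Definition gap (s : state R d p m) : R := sqn (gradF (w_cur s) - z_cur s).

Lemma sum_gap_le N :
  \sum_(k < N.+1) E N k gap <=
  Cstar * ((\sum_(k < N.+1) E N k (@Winc R d p m)) / (a ^+ 2 * b)).
Proof.
have abd := a_bounds; have bbd := b_bounds.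
have [a0 a1] := andP abd; have [b0 b1] := andP bbd.
have b2 : 0 <= b / 2 <= 1 / 2 by move: (b) b0 b1 => x x0 x1; apply/andP; split; lra.
have ab01 : 0 <= a * b <= 1.
  by move: (a) (b) a0 a1 b0 b1 => x y *; apply/andP; split; nra.
have I0 : (0 < I)%N by rewrite -(ltr0n R) I_E divr_gt0// mulr_gt0.
have msq0 (u : 'I_m -> 'cV[R]_p) : msq u u = 0.
  by rewrite /msq big1 ?mulr0// => i _; rewrite subrr sqn0.
have ge0E k (f : state R d p m -> R) : (forall s, 0 <= f s) -> 0 <= E N k f.
  exact: expect_at_ge0.
apply: (@gradient_error_sum R N a b (Cg ^+ 2) (Lf ^+ 2) (M1 Cf Lg) (M2 Lf Cg sigma) I%:R
  (fun k => E N k (Uerr gs)) (fun k => E N k (@Vinc R d p m))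
  (fun k => E N k (@Wanc R d p m)) (fun k => E N k (@Yanc R d p m))
  (fun k => E N k (Zerr Jg gradf)) (fun k => E N k (@Winc R d p m))
  (fun k => E N k gap)) => //.
- exact: sqr_ge0.
- exact: sqr_ge0.
- by apply: mulr_ge0; [apply: mulr_ge0 => //|]; exact: sqr_ge0.
- apply: mulr_ge0; last exact: sqr_ge0.
  by apply: mulr_ge0 => //; apply: addr_ge0; exact: sqr_ge0.
- by move=> k; apply: ge0E => s; exact: msq_ge0.
- by move=> k; apply: ge0E => s; exact: msq_ge0.
- by move=> k; apply: ge0E => s; exact: sqn_ge0.
- by move=> k; apply: ge0E => s; exact: msq_ge0.
- by move=> k; apply: ge0E => s; exact: sqn_ge0.
- by move=> k; apply: ge0E => s; exact: sqn_ge0.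
- by rewrite E0_init /Uerr (_ : u_cur _ = fun i => gfull gs i w1) ?msq0//; apply/funext.
- by rewrite E0_init /Vinc msq0.
- rewrite E0_init /Zerr /= z1E gradFE (_ : u1 = fun i => gfull gs i w1) ?subrr ?sqn0//.
  exact/funext.
- by rewrite E0_init /gap /= z1E subrr sqn0.
- move=> k kN; apply: (le_trans (expect_atS_le w1 u1 z1 B1m B2n kN
    (Uerr_step Jg gradf I (a * b) eta B1_gt0 B1m B2_gt0 B2n b2 g_lip gB_lip k.+2))).
  by rewrite !expect_atD !expect_atZ.
- move=> k kN; apply: (le_trans (expect_atS_le w1 u1 z1 B1m B2n kN
    (Vinc_step Jg gradf I (a * b) eta B1_gt0 B1m B2n b2 g_lip gB_lip k.+2))).
  by rewrite !expect_atD !expect_atZ.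
- move=> k kN; apply: (le_trans (expect_atS_le w1 u1 z1 B1m B2n kN
    (Zerr_step gs I (b / 2) eta B1_gt0 B1m B2_gt0 B2n ab01 f_lip f_smooth J_bound
       J_var JB_lip k.+2))).
  by rewrite !(expect_atD, expect_atZ).
- move=> k kN.
  pose h (s : state R d p m) (x : sample m n) :=
    2 * Zerr Jg gradf (step gs Jg gradf B1 B2 I (a * b) (b / 2) eta k.+2 s x)
    + 4 * Cg ^+ 2 * Lf ^+ 2 * (Uerr gs s + Cg ^+ 2 * Winc s).
  apply: (@le_trans _ _ (Epath B1 B2 (fun om : Defs.path m n N.+1 =>
    h (run gs Jg gradf B1 B2 I (a * b) (b / 2) eta w1 u1 z1 (path_fun om) k.+1)
      (path_fun om k.+2)))).
    apply: ler_avg => om _; rewrite /gap gradFE.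
    exact: (grad_error_step B2 I (a * b) (b / 2) eta B1_gt0 B1m f_smooth g_lip J_bound).
  rewrite -[X in X <= _]/(avg _ _) /h avgD !avgZ avgD avgZ.
  exact: lexx.
- exact: sum_Wanc_le.
- exact: sum_Yanc_le.
Qed.

Hypothesis eta0 : 0 <= eta.
Hypothesis L_eta : L * eta <= 1 / 4.
Hypothesis C_eta : Cstar * (eta ^+ 2 / (a ^+ 2 * b)) <= 1 / 2.

Lemma sum_gradF_le N :
  eta * \sum_(k < N.+1) E N k (fun s => sqn (gradF (w_cur s))) <= 2 * Delta.
Proof.
pose S k := E N k (fun s => sqn (z_cur s)).
pose G k := E N k (fun s => sqn (gradF (w_cur s))).
have WS k : E N k (@Winc R d p m) = eta ^+ 2 * S k.
  rewrite /S -expect_atZ; apply/eqP; rewrite eq_le.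
  by apply/andP; split; apply: expect_at_le => om;
    rewrite /Winc w_next_run addrC addrA addNr add0r sqnN sqnZ.
(* Polarisation: - eta <grad F, z> is eta/2 times |grad F - z|^2 - |grad F|^2 - |z|^2. *)
have desc k : E N k.+1 (fun s => F (w_cur s)) <=
    E N k (fun s => F (w_cur s)) + (- (eta / 2)) * G k + eta / 2 * E N k gap
    + (L * eta ^+ 2 - eta / 2) * S k.
  rewrite /G /S -!expect_atZ -!expect_atD.
  rewrite -[X in X <= _]/(E N k (fun s => F (w_next s))).
  apply: expect_at_le => om; rewrite w_next_run.
  set s := run _ _ _ _ _ _ _ _ _ _ _ _ _ _.
  apply: (le_trans (F_descent _ _)).
  rewrite sqnN sqnZ -scaleNr dotvZr /gap sqnB; lra.
have tele t : E N t (fun s => F (w_cur s)) + eta / 2 * \sum_(k < t) G k <=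
    F w1 + eta / 2 * \sum_(k < t) E N k gap + (L * eta ^+ 2 - eta / 2) * \sum_(k < t) S k.
  elim: t => [|t IH]; first by rewrite E0_init !big_ord0 !mulr0 !addr0.
  rewrite !big_ord_recr/=; have := desc t; lra.
(* Iteration N + 2 lies beyond the path and reads [default_sample], but its [w_cur] is [w_next] of
   iteration N + 1 and so does not depend on that sample. *)
have Flow : F w1 - Delta <= E N N.+1 (fun s => F (w_cur s)).
  rewrite -[X in X <= _]
    (expect_at_cst gs Jg gradf I (a * b) (b / 2) eta w1 u1 z1 B1m B2n N N.+1).
  by apply: expect_at_le => om; rewrite lerBlDr -lerBlDl F_bounded.
have S0 : 0 <= \sum_(k < N.+1) S k.
  by apply: sumr_ge0 => k _; apply: expect_at_ge0 => s; exact: sqn_ge0.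
(* The gap then contributes at most eta/4 times the total of |z|^2, and [L * eta ^+ 2 - eta / 2] is
   at most - eta/4 by [L_eta]: the two cancel. *)
have gapS : \sum_(k < N.+1) E N k gap <= 1 / 2 * \sum_(k < N.+1) S k.
  apply: (le_trans (sum_gap_le N)); under eq_bigr do rewrite WS.
  rewrite -mulr_sumr mulrAC mulrA; exact: ler_wpM2r.
suff : eta * \sum_(k < N.+1) G k <= 2 * Delta by [].
move: Flow (tele N.+1) (ler_wpM2l eta0 gapS) (ler_wpM2r (mulr_ge0 eta0 S0) L_eta).
move: (E N N.+1 _) (\sum_(k < N.+1) G k) (\sum_(k < N.+1) S k)
  (\sum_(k < N.+1) E N k gap) => x g s q; lra.
Qed.

End Convergence.

Theorem theorem4 (R : realType) (Lf Cf Lg Cg sigma DeltaF : R) :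
  0 < Lf -> 0 < Cf -> 0 < Lg -> 0 < Cg -> 0 < sigma -> 0 < DeltaF ->
  exists c1 c2 c3 K : R, [/\ 0 < c1, 0 < c2, 0 < c3, 0 < K &
  forall (d p m n B1 B2 : nat)
    (f : 'I_m -> 'cV[R]_p -> R) (gradf : 'I_m -> 'cV[R]_p -> 'cV[R]_p)
    (gs : 'I_m -> 'I_n -> 'cV[R]_d -> 'cV[R]_p)
    (Jg : 'I_m -> 'I_n -> 'cV[R]_d -> 'M[R]_(p, d))
    (gradF : 'cV[R]_d -> 'cV[R]_d)
    (w1 : 'cV[R]_d) (u1 : 'I_m -> 'cV[R]_p) (z1 : 'cV[R]_d)
    (I : nat) (alpha beta eta eps : R) (T : nat),
    (* batch sizes and parameters *)
    (0 < B1)%N -> (B1 <= m)%N -> (0 < B2)%N -> (B2 <= n)%N ->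
    (B1 * B2 %| m * n)%N -> I = (m * n %/ (B1 * B2))%N ->
    alpha = c1 * (B1 * B2)%:R / (m * n)%:R ->
    beta = c2 * B2%:R / n%:R ->
    eta = c3 * (B1%:R * Num.sqrt B2%:R) / (m%:R * Num.sqrt n%:R) ->
    (* Jg, gradf, gradF are the (Jacobians / gradients) derivatives *)
    (forall i j w, differentiable (gs i j) w /\
       forall h, 'd (gs i j) w h = Jg i j w *m h) ->
    (forall i u, differentiable (f i) u /\
       forall h, 'd (f i) u h = dotv (gradf i u) h) ->
    (forall w, differentiable (Fobj f gs) w /\
       forall h, 'd (Fobj f gs) w h = dotv (gradF w) h) ->
    (* (A1) *)
    (forall i u v, `|f i u - f i v| <= Cf * enorm (u - v)) ->
    (forall i u v, enorm (gradf i u - gradf i v) <= Lf * enorm (u - v)) ->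
    (forall i x y, enorm (gfull gs i x - gfull gs i y) <= Cg * enorm (x - y)) ->
    (forall i x y, fnorm (Jfull Jg i x - Jfull Jg i y) <= Lg * enorm (x - y)) ->
    (* (A2) *)
    (forall i x, Ebatch B2 (fun xi => enorm (gB gs B2 i xi x - gfull gs i x) ^+ 2)
                   <= sigma ^+ 2 / B2%:R) ->
    (forall i x, Ebatch B2 (fun xi => fnorm (JB Jg B2 i xi x - Jfull Jg i x) ^+ 2)
                   <= sigma ^+ 2 / B2%:R) ->
    (* (A3) *)
    (forall i x y, Ebatch B2 (fun xi => enorm (gB gs B2 i xi x - gB gs B2 i xi y) ^+ 2)
                     <= Cg ^+ 2 * enorm (x - y) ^+ 2) ->
    (forall i x y, Ebatch B2 (fun xi => fnorm (JB Jg B2 i xi x - JB Jg B2 i xi y) ^+ 2)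
                     <= Lg ^+ 2 * enorm (x - y) ^+ 2) ->
    (* (A4) *)
    (forall w, Fobj f gs w1 - Fobj f gs w <= DeltaF) ->
    (* initialisation of the estimators *)
    (forall i, u1 i = gfull gs i w1) -> z1 = gradF w1 ->
    (* iteration count *)
    0 < eps -> (0 < T)%N ->
    K * (m%:R * Num.sqrt n%:R) / (B1%:R * Num.sqrt B2%:R * eps ^+ 2) <= T%:R ->
    expected_output_gradnorm gs Jg gradf B1 B2 I alpha beta eta w1 u1 z1 gradF T
      <= eps].
Proof.
move=> Lf0 Cf0 Lg0 Cg0 sg0 De0.
pose L := 2 * (Lg * Cf + Cg ^+ 2 * Lf).
pose C := Cstar Lf Cf Lg Cg sigma.
have L0 : 0 <= L.
  apply: mulr_ge0 => //; apply: addr_ge0; apply: mulr_ge0; rewrite ?ltW//.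
  exact: exprn_gt0.
have C0 : 0 <= C.
  have Cg2 := sqr_ge0 Cg; have Lf2 := sqr_ge0 Lf; have M10 : 0 <= M1 Cf Lg.
    by apply: mulr_ge0; [apply: mulr_ge0 => //|]; exact: sqr_ge0.
  have M20 : 0 <= M2 Lf Cg sigma.
    by apply: mulr_ge0 => //; apply: mulr_ge0 => //; apply: addr_ge0 => //; exact: sqr_ge0.
  apply: addr_ge0; first apply: addr_ge0.
  - by apply: mulr_ge0 M10; exact: ler0n.
  - by apply: mulr_ge0 Cg2; apply: mulr_ge0 M20; exact: ler0n.
  - apply: mulr_ge0 Lf2; apply: mulr_ge0; [exact: ler0n|exact: sqr_ge0].
(* Each summand of [q] secures one requirement on its inverse: [c3 <= 1], [C * c3 <= 1 / 2] and
   [L * c3 <= 1 / 4]. *)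
pose q := 1 + 2 * C + 4 * L.
have q1 : 1 <= q by rewrite /q; lra.
have q0 : 0 < q by lra.
pose c3 := q^-1.
have c30 : 0 < c3 by rewrite invr_gt0.
have c31 : c3 <= 1 by rewrite invf_le1.
have c3q : c3 * q = 1 by rewrite mulVf// gt_eqF.
have c3L : L * c3 <= 1 / 4 by move: c3q; rewrite /q; nra.
have c3C : C * c3 ^+ 2 <= 1 / 2.
  have : C * c3 <= 1 / 2 by move: c3q; rewrite /q; nra.
  move: (mulr_ge0 C0 (ltW c30)); nra.
clearbody c3.
(* [c1 = 1] makes [alpha] the inverse of [I], [c2 = 1 / 2] keeps [beta] at most 1/2, and the last
   constant makes T eta eps^2 at least 2 [DeltaF]. *)
exists 1, (1 / 2), c3, (2 * DeltaF / c3); split => //.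
  by apply: divr_gt0 => //; exact: mulr_gt0.
move=> d p m n B1 B2 f gradf gs Jg gradF w1 u1 z1 I alpha beta eta eps T.
move=> B10 B1m B20 B2n Idvd IE alphaE betaE etaE gsd fd Fd hf hLf hg hJ _ hvJ hgB hJB.
move=> hF hu1 hz1 eps0 T0 TK.
have m0 : (0 < m)%N by exact: leq_trans B1m.
have n0 : (0 < n)%N by exact: leq_trans B2n.
have m0R : 0 < m%:R :> R by rewrite ltr0n.
have n0R : 0 < n%:R :> R by rewrite ltr0n.
have B10R : 0 < B1%:R :> R by rewrite ltr0n.
have B20R : 0 < B2%:R :> R by rewrite ltr0n.
have sn0 : 0 < Num.sqrt n%:R :> R by rewrite sqrtr_gt0.
have sB0 : 0 < Num.sqrt B2%:R :> R by rewrite sqrtr_gt0.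
pose a : R := B1%:R / m%:R; pose b : R := B2%:R / n%:R.
have a0 : 0 < a by exact: divr_gt0.
have b0 : 0 < b by exact: divr_gt0.
have a1 : a <= 1 by rewrite ler_pdivrMr// mul1r ler_nat.
have alphaE' : alpha = a * b.
  by rewrite alphaE !natrM /a /b mul1r; field; rewrite !gt_eqF.
have betaE' : beta = b / 2 by rewrite betaE /b; field; rewrite !gt_eqF.
pose r : R := Num.sqrt B2%:R / Num.sqrt n%:R.
have r0 : 0 < r by exact: divr_gt0.
have r2 : r ^+ 2 = b by rewrite /r expr_div_n !sqr_sqrtr// ltW.
have r1 : r <= 1 by rewrite ler_pdivrMr// mul1r ler_sqrt// ler_nat.
have etaE' : eta = c3 * (a * r).
  by rewrite etaE /a /r; field; rewrite !gt_eqF.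
clearbody r.
(* Divisibility makes the epoch length exactly [1 / (a * b)], without rounding. *)
have I_E : I%:R = 1 / (a * b).
  have : (I * (B1 * B2))%:R = (m * n)%:R :> R by rewrite IE divnK.
  rewrite !natrM => h; rewrite /a /b.
  have -> : I%:R = I%:R * (B1%:R * B2%:R) / (B1%:R * B2%:R) :> R.
    by rewrite mulfK// mulf_neq0// gt_eqF.
  by rewrite h; field; rewrite !gt_eqF.
have eta0 : 0 < eta by rewrite etaE'; apply: mulr_gt0 => //; exact: mulr_gt0.
have sqf_lip i x y : sqf (Jfull Jg i x - Jfull Jg i y) <= Lg ^+ 2 * sqn (x - y).
  rewrite -sqr_fnorm -sqr_enorm -exprMn ler_sqr ?nnegrE ?hJ//; first exact: sqrtr_ge0.
  by apply: mulr_ge0; [exact: ltW|exact: enorm_ge0].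
have f_lip i u : sqn (gradf i u) <= Cf ^+ 2.
  exact: (grad_bound (ltW Cf0) (fd i) (hf i)).
have f_smooth i u v : sqn (gradf i u - gradf i v) <= Lf ^+ 2 * sqn (u - v).
  rewrite -!sqr_enorm -exprMn ler_sqr ?nnegrE ?enorm_ge0//.
  by apply: mulr_ge0; [exact: ltW|exact: enorm_ge0].
have g_lip i x y : sqn (gfull gs i x - gfull gs i y) <= Cg ^+ 2 * sqn (x - y).
  rewrite -!sqr_enorm -exprMn ler_sqr ?nnegrE ?enorm_ge0//.
  by apply: mulr_ge0; [exact: ltW|exact: enorm_ge0].
have J_bound i x v : sqn ((Jfull Jg i x)^T *m v) <= Cg ^+ 2 * sqn v.
  exact: (jacobian_bound (ltW Cg0) (diff_gfull gsd i) (hg i)).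
have J_var i x :
    Ebatch B2 (fun xi => sqf (JB Jg B2 i xi x - Jfull Jg i x)) <= sigma ^+ 2.
  have := hvJ i x.
  rewrite [X in X <= _ -> _](@eq_avg _ _ _ _ (fun xi => sqf (JB Jg B2 i xi x - Jfull Jg i x))).
    move=> /le_trans; apply; rewrite ler_pdivrMr// ler_peMr ?sqr_ge0//.
    by rewrite ler1n.
  by move=> xi _; rewrite sqr_fnorm.
have gB_lip i x y : Ebatch B2 (fun xi => sqn (gB gs B2 i xi x - gB gs B2 i xi y)) <=
    Cg ^+ 2 * sqn (x - y).
  rewrite -sqr_enorm; apply: le_trans (hgB i x y).
  by apply: ler_avg => xi _; rewrite sqr_enorm.
have JB_lip i x y : Ebatch B2 (fun xi => sqf (JB Jg B2 i xi x - JB Jg B2 i xi y)) <=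
    Lg ^+ 2 * sqn (x - y).
  rewrite -sqr_enorm; apply: le_trans (hJB i x y).
  by apply: ler_avg => xi _; rewrite sqr_fnorm.
have gradFE := gradF_eq gsd fd Fd.
have gradF_lip x y : enorm (gradF x - gradF y) <= L * enorm (x - y).
  rewrite !gradFE; exact: (Gbar_diag_lip m0 (ltW Lf0) (ltW Cf0) (ltW Lg0) (ltW Cg0)).
have F_desc := descent L0 Fd gradF_lip.
have Leta : L * eta <= 1 / 4.
  have ar1 : a * r <= 1 by nra.
  apply: le_trans c3L; apply: ler_wpM2l => //; rewrite etaE'.
  by rewrite ler_piMr// ltW.
have Ceta : Cstar Lf Cf Lg Cg sigma * (eta ^+ 2 / (a ^+ 2 * b)) <= 1 / 2.
  rewrite -/C etaE' !exprMn r2 (_ : _ / _ = c3 ^+ 2)//.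
  by field; rewrite !gt_eqF.
case: T T0 TK => // N _ TK.
have sumle := sum_gradF_le B10 B1m B20 B2n f_lip f_smooth g_lip J_bound J_var gB_lip JB_lip
  gradFE F_desc hF hu1 hz1 I_E (ltW eta0) Leta Ceta N.
rewrite /expected_output_gradnorm alphaE' betaE'.
rewrite -[X in X <= _]/(avg _ _) avgZ.
under eq_avg do rewrite big_add1 /= big_mkord.
rewrite avg_sum.
pose G k := expect_at gs Jg gradf B1 B2 I (a * b) (b / 2) eta w1 u1 z1 N k
  (fun s => sqn (gradF (w_cur s))).
rewrite -/a -/b in sumle.
(* The inequality x <= eps/2 + x^2/(2 eps) passes from squared norms to norms without Jensen; the
   mean of [G] being at most eps^2, each half contributes eps/2. *)
have termle k : expect_at gs Jg gradf B1 B2 I (a * b) (b / 2) eta w1 u1 z1 N k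
    (fun s => enorm (gradF (w_cur s))) <= eps / 2 + (2 * eps)^-1 * G k.
  rewrite -[eps / 2](expect_at_cst gs Jg gradf I (a * b) (b / 2) eta w1 u1 z1 B1m B2n N k).
  rewrite -expect_atZ -expect_atD; apply: expect_at_le => om.
  rewrite -sqr_enorm; move: (enorm _) => x.
  rewrite -subr_ge0 (_ : _ - _ = (x - eps) ^+ 2 / (2 * eps)); last by field; rewrite gt_eqF.
  by apply: divr_ge0; [exact: sqr_ge0|apply: mulr_ge0 => //; exact: ltW].
apply: (@le_trans _ _ (N.+1%:R^-1 * \sum_(k < N.+1) (eps / 2 + (2 * eps)^-1 * G k))).
  by rewrite ler_wpM2l ?invr_ge0 ?ler0n//; apply: ler_sum => k _; exact: termle.
have N0 : 0 < N.+1%:R :> R by rewrite ltr0n.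
rewrite ler_pdivrMl// big_split/= sumr_const card_ord -[eps / 2 *+ _]mulr_natl -mulr_sumr.
have {}sumle : eta * \sum_(k < N.+1) G k <= 2 * DeltaF := sumle.
have TK' : 2 * DeltaF <= N.+1%:R * eta * eps ^+ 2.
  move: TK; have -> : 2 * DeltaF / c3 * (m%:R * Num.sqrt n%:R) /
      (B1%:R * Num.sqrt B2%:R * eps ^+ 2) = 2 * DeltaF / (eta * eps ^+ 2).
    by rewrite etaE; field; rewrite !gt_eqF.
  rewrite ler_pdivrMr; last by apply: mulr_gt0 => //; exact: exprn_gt0.
  by move=> /le_trans; apply; rewrite mulrA.
have : \sum_(k < N.+1) G k <= N.+1%:R * eps ^+ 2.
  rewrite -(ler_pM2l eta0) (le_trans sumle)// (le_trans TK')//.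
  by rewrite le_eqVlt; apply/orP; left; apply/eqP; ring.
rewrite -(ler_pM2l (_ : 0 < (2 * eps)^-1)); last by rewrite invr_gt0 mulr_gt0.
have -> : (2 * eps)^-1 * (N.+1%:R * eps ^+ 2) = N.+1%:R * (eps / 2).
  by field; rewrite gt_eqF.
move: (_^-1 * _) => x; lra.
Qed.
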